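(* Let $\tau$ be an nc-topology on $\mathbb{M}^d$, let $\Omega\in\tau$, let $\mathcal{H}$ be a Hilbert space, and let $\{u^k\}$ be a $\tau$-locally uniformly bounded sequence in $\mathrm{Hol}^\tau_{\mathcal{H}}(\Omega)$. Then there exist $u\in \mathrm{Hol}^\tau_{\mathcal{H}}(\Omega)$, a sequence $\{U^k\}$ of unitary operators on $\mathcal{H}$, and an increasing sequence of indices $\{k_l\}$ such that $U^{k_l}*u^{k_l}\to u$ in $\mathrm{Hol}_{\mathcal{H}}(\Omega)$ as $l\to\infty$, where $U*f$ denotes the function given on each $\Omega_n$ by $(U*f)(\lambda)=(\mathrm{id}_n\otimes U)f(\lambda)$.
   Context: Hilbert spaces are complex. $\mathbb{M}_n^d$ is the set of $d$-tuples of $n\times n$ complex matrices, $\mathbb{M}^d=\bigcup_{n\ge1}\mathbb{M}^d_n$, and $E_n=E\cap\mathbb{M}^d_n$ for $E\subseteq\mathbb{M}^d$. The finite topology on $\mathbb{M}^d$: $\Omega$ is (finitely) open iff $\Omega_n$ is open in $\mathbb{M}^d_n$ for every $n$; a set $K$ is finitely compact iff every $K_n$ is compact and $K_n=\varnothing$ for all large $n$. An $\mathcal{H}$-graded function on $E\subseteq\mathbb{M}^d$ is a function $f$ with $f(\lambda)\in\mathcal{B}(\mathbb{C}^n,\mathbb{C}^n\otimes\mathcal{H})$ for all $n$ and $\lambda\in E_n$. For finitely open $\Omega$, $\mathrm{Hol}_{\mathcal{H}}(\Omega)$ is the set of $\mathcal{H}$-graded functions $f$ on $\Omega$ such that $f|\Omega_n$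 is holomorphic for every $n$, with the topology of uniform convergence (in operator norm) on finitely compact subsets of $\Omega$. An $\mathcal{H}$-valued nc-function on $E$ is a function $f$ on $E$ such that: (i) $f$ is $\mathcal{H}$-graded; (ii) $f(\lambda\oplus\mu)=f(\lambda)\oplus f(\mu)$ whenever $\lambda,\mu,\lambda\oplus\mu\in E$ (identifying $\mathbb{C}^m\oplus\mathbb{C}^n$ with $\mathbb{C}^{m+n}$ and $(\mathbb{C}^m\otimes\mathcal{H})\oplus(\mathbb{C}^n\otimes\mathcal{H})$ with $\mathbb{C}^{m+n}\otimes\mathcal{H}$); (iii) $f(S\lambda S^{-1})=(S\otimes\mathrm{id}_{\mathcal{H}})f(\lambda)S^{-1}$ whenever $n\ge1$, $S$ is an invertible $n\times n$ matrix, and $\lambda,S\lambda S^{-1}\in E_n$ (direct sums and similarities of $d$-tuples are taken componentwise). An nc-set is a subset of $\mathbb{M}^d$ closed under direct sums; an nc-domain is a finitely open nc-set; an nc-topology is a topology on $\mathbb{M}^d$ having a basis consisting of nc-domains. For an nc-topology $\tau$ and $\Omega\in\tau$, $\mathrm{Hol}^\tau_{\mathcal{H}}(\Omega)$ is the set of $\mathcal{H}$-valued nc-functions $f$ on $\Omega$ that are $\tau$-locally bounded, i.e. for each $\lambda\in\Omega$ there is $B\in\tau$ with $\lambda\in B\subseteq\Omega$ and $\sup_{\mu\in B}\|f(\mu)\|<\infty$. (It is a known fact that $\mathrm{Hol}^\tau_{\mathcal{H}}(\Omega)\subseteq\mathrm{Hol}_{\mathcal{H}}(\Omega)$.) A sequence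 $\{u^k\}$ in $\mathrm{Hol}^\tau_{\mathcal{H}}(\Omega)$ is $\tau$-locally uniformly bounded on $\Omega$ if for each $\lambda\in\Omega$ there is $B\in\tau$ with $\lambda\in B\subseteq\Omega$ and $\sup_k\sup_{\mu\in B}\|u^k(\mu)\|<\infty$. *)

(* Defs.v *)
From HB Require Import structures.
From mathcomp Require Import all_boot all_order all_algebra.
From mathcomp Require Import all_classical all_reals all_analysis.
From mathcomp Require Import complex sesquilinear ring.

Set Implicit Arguments.
Unset Strict Implicit.
Unset Printing Implicit Defensive.

Import Order.TTheory GRing.Theory Num.Theory.
Import numFieldNormedType.Exports.

Local Open Scope classical_set_scope.
Local Open Scope ring_scope.
Local Open Scope complex_scope.

(* d-tuples of n x n complex matrices.  Any norm on this finite-dimensional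
   space yields its usual topology and its usual holomorphic functions. *)
Definition mtuple (R : realType) (d n : nat) := {ffun 'I_d -> 'M[R[i]]_n}.

HB.instance Definition _ (R : realType) (d n : nat) :=
  GRing.Lmodule.on (mtuple R d n).

Section MtupleNorm.
Context {R : realType} {d n : nat}.
Implicit Types x y : mtuple R d n.

Definition mtuple_norm x : R[i] := \sum_i `|x i|.

Let ler_mtuple_normD x y : mtuple_norm (x + y) <= mtuple_norm x + mtuple_norm y.
Proof.
by rewrite /mtuple_norm -big_split; apply: ler_sum => i _; rewrite ffunE ler_normD.
Qed.

Let mtuple_normZ (c : R[i]) x : mtuple_norm (c *: x) = `|c| * mtuple_norm x.
Proof.
by rewrite /mtuple_norm mulr_sumr; apply: eq_bigr => i _; rewrite ffunE normrZ.
Qed.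

Let mtuple_norm_eq0 x : mtuple_norm x = 0 -> x = 0.
Proof.
move=> /eqP; rewrite psumr_eq0 // => /allP x0; apply/ffunP => i; rewrite ffunE.
by apply/eqP; rewrite -normr_eq0; apply: x0; rewrite mem_index_enum.
Qed.

HB.instance Definition _ := Lmodule_isNormed.Build R[i] (mtuple R d n)
  ler_mtuple_normD mtuple_normZ mtuple_norm_eq0.
End MtupleNorm.

(* Euclidean norm; with V := H this is the Hilbert norm of
   C^n (x) H, identified with the orthogonal sum H^n. *)
Definition l2norm (R : realType) (V : normedZmodType R[i]) (n : nat)
  (w : 'cV[V]_n) : R := Num.sqrt (\sum_i complex.Re `|w i 0| ^+ 2).

(* B(C^n, C^n (x) H): an operator T is stored as its matrix A with entries in H,
   so that T e_j = \sum_i e_i (x) A i j. *)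
Definition grop (R : realType) (H : normedModType R[i]) (n : nat) := 'M[H]_n.

HB.instance Definition _ (R : realType) (H : normedModType R[i]) (n : nat) :=
  GRing.Zmodule.on (grop H n).

Section GropLmodule.
Context {R : realType} {H : normedModType R[i]} {n : nat}.
Implicit Types A : grop H n.

Definition grop_scale (c : R[i]) A : grop H n := map_mx (fun h : H => c *: h) A.

Let grop_scaleA a b A : grop_scale a (grop_scale b A) = grop_scale (a * b) A.
Proof. by apply/matrixP => i j; rewrite !mxE scalerA. Qed.

Let grop_scale1 A : grop_scale 1 A = A.
Proof. by apply/matrixP => i j; rewrite !mxE scale1r. Qed.

Let grop_scaleDr : right_distributive grop_scale +%R.
Proof. by move=> c A B; apply/matrixP => i j; rewrite !mxE scalerDr. Qed.

Let grop_scaleDl A : {morph grop_scale^~ A : a b / a + b}.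
Proof. by move=> a b; apply/matrixP => i j; rewrite !mxE scalerDl. Qed.

HB.instance Definition _ := GRing.Zmodule_isLmodule.Build R[i] (grop H n)
  grop_scaleA grop_scale1 grop_scaleDr grop_scaleDl.
End GropLmodule.

Section OperatorNorm.
Context {R : realType} {H : normedModType R[i]} {n : nat}.
Implicit Types (A B : grop H n) (v : 'cV[R[i]]_n).

Definition gapp A v : 'cV[H]_n := \col_i \sum_j v j 0 *: A i j.

Definition opnorm A : R :=
  sup [set l2norm (gapp A v) | v in [set v | l2norm v <= 1]].

Let reN (V : normedZmodType R[i]) (x : V) : (complex.Re `|x|)%:C = `|x|.
Proof. by have := normr_ge0 x; case: `|x| => a b; rewrite lecE /= => /andP[/eqP -> _]. Qed.

Let reN_ge0 (V : normedZmodType R[i]) (x : V) : 0 <= complex.Re `|x|.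
Proof. by have := normr_ge0 x; case: `|x| => a b; rewrite lecE /= => /andP[_ ->]. Qed.

Let reND (V : normedZmodType R[i]) (x y : V) :
  complex.Re `|x + y| <= complex.Re `|x| + complex.Re `|y|.
Proof. by rewrite -lecR rmorphD/= !reN ler_normD. Qed.

Let reNZ (V : normedModType R[i]) (c : R[i]) (x : V) :
  complex.Re `|c *: x| = complex.Re `|c| * complex.Re `|x|.
Proof. by apply: complexI; rewrite rmorphM/= !reN normrZ. Qed.

Let sqr_sum_ge0 m (a : 'I_m -> R) : 0 <= \sum_i a i ^+ 2.
Proof. by apply: sumr_ge0 => i _; exact: sqr_ge0. Qed.

Let cauchy_schwarz_sum m (a b : 'I_m -> R) :
  (\sum_i a i * b i) ^+ 2 <= (\sum_i a i ^+ 2) * (\sum_i b i ^+ 2).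
Proof.
have : 0 <= \sum_i \sum_j (a i * b j - a j * b i) ^+ 2.
  by apply: sumr_ge0 => i _; apply: sumr_ge0 => j _; exact: sqr_ge0.
have -> : \sum_i \sum_j (a i * b j - a j * b i) ^+ 2 =
    ((\sum_i a i ^+ 2) * (\sum_i b i ^+ 2) - (\sum_i a i * b i) ^+ 2) *+ 2.
  have P (f g : 'I_m -> R) : (\sum_i f i) * (\sum_j g j) =
      \sum_i \sum_j f i * g j.
    by rewrite mulr_suml; apply: eq_bigr => i _; rewrite mulr_sumr.
  have Q (f g : 'I_m -> R) : \sum_i \sum_j f i * g j = \sum_i \sum_j f j * g i.
    by rewrite exchange_big.
  rewrite expr2 mulr2n !P {2}Q -!sumrB -big_split; apply: eq_bigr => i _.
  rewrite -!sumrB -big_split; apply: eq_bigr => j _ /=; ring.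
by rewrite pmulrn_lge0 // subr_ge0.
Qed.

Let sqrt_sum_D m (a b : 'I_m -> R) : Num.sqrt (\sum_i (a i + b i) ^+ 2) <=
  Num.sqrt (\sum_i a i ^+ 2) + Num.sqrt (\sum_i b i ^+ 2).
Proof.
have s0 : 0 <= Num.sqrt (\sum_i a i ^+ 2) + Num.sqrt (\sum_i b i ^+ 2).
  by rewrite addr_ge0 ?sqrtr_ge0.
rewrite -(ger0_norm s0) -sqrtr_sqr ler_wsqrtr // sqrrD !sqr_sqrtr //.
rewrite -sqrtrM //.
have -> : \sum_i (a i + b i) ^+ 2 =
    \sum_i a i ^+ 2 + (\sum_i a i * b i) *+ 2 + \sum_i b i ^+ 2.
  by rewrite -sumrMnl -!big_split; apply: eq_bigr => i _; rewrite sqrrD.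
rewrite lerD2r lerD2l lerMn2r /=.
apply: le_trans (ler_norm _) _; rewrite -sqrtr_sqr ler_wsqrtr //.
exact: cauchy_schwarz_sum.
Qed.

Lemma l2norm_ge0 (V : normedZmodType R[i]) m (w : 'cV[V]_m) : 0 <= l2norm w.
Proof. exact: sqrtr_ge0. Qed.

Lemma l2normD (V : normedZmodType R[i]) m (v w : 'cV[V]_m) :
  l2norm (v + w) <= l2norm v + l2norm w.
Proof.
apply: le_trans (sqrt_sum_D _ _); rewrite ler_wsqrtr //; apply: ler_sum => i _.
rewrite mxE lerXn2r ?nnegrE ?addr_ge0 //.
Qed.

Lemma l2norm_coord (V : normedZmodType R[i]) m (w : 'cV[V]_m) i :
  complex.Re `|w i 0| <= l2norm w.
Proof.
rewrite -(ger0_norm (reN_ge0 (w i 0))) -sqrtr_sqr ler_wsqrtr //.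
by rewrite (bigD1 i) //= lerDl sumr_ge0 // => j _; exact: sqr_ge0.
Qed.

Lemma l2norm_sum (V : normedZmodType R[i]) m (w : 'cV[V]_m) :
  l2norm w <= \sum_i complex.Re `|w i 0|.
Proof.
have s0 : 0 <= \sum_i complex.Re `|w i 0| by apply: sumr_ge0.
rewrite -(ger0_norm s0) -sqrtr_sqr ler_wsqrtr // expr2 mulr_suml.
apply: ler_sum => i _; rewrite expr2 ler_wpM2l //.
by rewrite (bigD1 i) //= lerDl sumr_ge0.
Qed.

Lemma l2norm_scale (V : normedModType R[i]) m (c : R[i]) (w : 'cV[V]_m) :
  l2norm (map_mx (fun h : V => c *: h) w) = complex.Re `|c| * l2norm w.
Proof.
rewrite /l2norm; under eq_bigr do rewrite mxE reNZ exprMn.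
by rewrite -mulr_sumr sqrtrM ?sqr_ge0 // sqrtr_sqr ger0_norm ?reN_ge0 //.
Qed.

Lemma gappD A B v : gapp (A + B) v = gapp A v + gapp B v.
Proof.
apply/matrixP => i j; rewrite !mxE -big_split; apply: eq_bigr => k _.
by rewrite mxE scalerDr.
Qed.

Lemma gappZ c A v : gapp (c *: A) v = map_mx (fun h : H => c *: h) (gapp A v).
Proof.
apply/matrixP => i j; rewrite !mxE scaler_sumr; apply: eq_bigr => k _.
by rewrite mxE !scalerA mulrC.
Qed.

Let l2norm0 : l2norm (0 : 'cV[R[i]]_n) = 0.
Proof.
rewrite /l2norm big1 ?sqrtr0 // => i _.
by rewrite mxE normr0 /= expr2 mul0r.
Qed.

Lemma has_sup_opnorm A :
  has_sup [set l2norm (gapp A v) | v in [set v | l2norm v <= 1]].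
Proof.
split; first by exists (l2norm (gapp A 0)), 0 => //=; rewrite l2norm0 ler01.
exists (\sum_i \sum_j complex.Re `|A i j|) => _ /= [v v1 <-].
apply: le_trans (l2norm_sum _) _; apply: ler_sum => i _; rewrite mxE.
apply: (big_ind2 (fun (h : H) (r : R) => complex.Re `|h| <= r)) => [|a b c e ab ce|j _]; first by rewrite normr0.
  exact: le_trans (reND _ _) (lerD ab ce).
rewrite reNZ -[leRHS]mul1r ler_wpM2r ?reN_ge0 //.
exact: le_trans (l2norm_coord v j) v1.
Qed.

Lemma gapp_le_opnorm A v : l2norm v <= 1 -> l2norm (gapp A v) <= opnorm A.
Proof.
move=> v1; have [_ hb] := has_sup_opnorm A.
by apply: (ub_le_sup hb); exists v.
Qed.

Lemma opnorm_le A (M : R) :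
  (forall v, l2norm v <= 1 -> l2norm (gapp A v) <= M) -> opnorm A <= M.
Proof.
move=> AM; apply: ge_sup; first by have [] := has_sup_opnorm A.
by move=> _ /= [v v1 <-]; exact: AM.
Qed.

Lemma opnorm_ge0 A : 0 <= opnorm A.
Proof.
apply: le_trans (gapp_le_opnorm A (v := 0) _); first exact: l2norm_ge0.
by rewrite l2norm0 ler01.
Qed.

Let ler_opnormD A B : (opnorm (A + B))%:C <= (opnorm A)%:C + (opnorm B)%:C.
Proof.
rewrite -rmorphD/= lecR; apply: opnorm_le => v v1; rewrite gappD.
by apply: le_trans (l2normD _ _) _; rewrite lerD // gapp_le_opnorm.
Qed.

Let opnormZ_le c A : opnorm (c *: A) <= complex.Re `|c| * opnorm A.
Proof.
apply: opnorm_le => v v1; rewrite gappZ l2norm_scale.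
by rewrite ler_wpM2l ?reN_ge0 ?gapp_le_opnorm.
Qed.

Let opnormZ (c : R[i]) A : (opnorm (c *: A))%:C = `|c| * (opnorm A)%:C.
Proof.
suff -> : opnorm (c *: A) = complex.Re `|c| * opnorm A
  by rewrite [LHS]rmorphM; congr (_ * _); exact: reN.
apply/eqP; rewrite eq_le opnormZ_le andTb.
have [->|c0] := eqVneq c 0; first by rewrite normr0 mul0r opnorm_ge0.
have rc0 : 0 < complex.Re `|c| by rewrite -ltcR reN normr_gt0.
rewrite mulrC -ler_pdivlMr // mulrC.
have := opnormZ_le c^-1 (c *: A); rewrite scalerA mulVf // scale1r.
suff -> : complex.Re `|c^-1| = (complex.Re `|c|)^-1 by [].
apply: complexI; rewrite reN normfV -[X in X^-1](reN c); exact/esym/fmorphV.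
Qed.

Let opnorm_eq0 A : (opnorm A)%:C = 0 -> A = 0.
Proof.
move=> /complexI A0; apply/matrixP => i j; rewrite [RHS]mxE.
pose e : 'cV[R[i]]_n := delta_mx j 0.
have e1 : l2norm e <= 1.
  apply: le_trans (l2norm_sum _) _; rewrite (bigD1 j) // big1 ?addr0.
    by rewrite [leLHS]addr0 mxE !eqxx andbT [X in complex.Re X]normr1 lexx.
  by move=> k /andP[_ kj]; rewrite mxE (negbTE kj) [X in complex.Re X]normr0.
have := le_trans (l2norm_coord _ i) (gapp_le_opnorm A e1).
rewrite A0 mxE (bigD1 j) //= big1 ?addr0; last first.
  by move=> k kj; rewrite mxE (negbTE kj) /= scale0r.
rewrite mxE !eqxx scale1r => Aij.
by apply/eqP; rewrite -normr_eq0 -reN eq_le !lecR Aij reN_ge0.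
Qed.

HB.instance Definition _ := Lmodule_isNormed.Build R[i] (grop H n)
  ler_opnormD opnormZ opnorm_eq0.

Lemma grop_normE A : `|A| = (opnorm A)%:C.
Proof. by []. Qed.
End OperatorNorm.

Section NCSets.
Context {R : realType} {d : nat}.

(* A point with first component n is a tuple of matrices of size n.+1. *)
Definition Md := {n : nat & mtuple R d n.+1}.

Definition pt (n : nat) (x : mtuple R d n.+1) : Md := existT _ n x.

Definition slice (E : set Md) (n : nat) : set (mtuple R d n.+1) :=
  [set x | E (pt x)].
Arguments slice E n _ : clear implicits.

Definition finitely_open (E : set Md) : Prop := forall n, open (slice E n).

Definition finitely_compact (K : set Md) : Prop :=
  (forall n, compact (slice K n)) /\ (\forall n \near \oo, slice K n = set0).

Definition dsum (m n : nat) (x : mtuple R d m) (y : mtuple R d n) :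
  mtuple R d (m + n) := [ffun i => block_mx (x i) 0 0 (y i)].

Definition conj_tuple (n : nat) (S : 'M[R[i]]_n) (x : mtuple R d n) :
  mtuple R d n := [ffun i => S *m x i *m invmx S].

Definition nc_set (E : set Md) : Prop :=
  forall (m n : nat) (x : mtuple R d m.+1) (y : mtuple R d n.+1),
    E (pt x) -> E (pt y) -> E (@pt (m + n.+1) (dsum x y)).

Definition nc_domain (E : set Md) : Prop := finitely_open E /\ nc_set E.

Definition is_topology (tau : set (set Md)) : Prop :=
  [/\ tau setT,
      setI_closed tau
    & forall (I : Type) (F : I -> set Md),
        (forall i, tau (F i)) -> tau (\bigcup_i F i)].

Definition is_basis (tau BB : set (set Md)) : Prop :=
  BB `<=` tau /\
  forall A, tau A -> forall p, A p -> exists B, [/\ BB B, B p & B `<=` A].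

Definition nc_topology (tau : set (set Md)) : Prop :=
  is_topology tau /\ exists BB, is_basis tau BB /\ BB `<=` nc_domain.
End NCSets.

Arguments Md : clear implicits.
Arguments slice {R d} E n _.

Section GradedFunctions.
Context {R : realType} {d : nat} {H : completeNormedModType R[i]}.
Implicit Types (tau : set (set (Md R d))) (Omega : set (Md R d)).

(* Functions on a subset E of Md are represented by total functions whose values
   outside E are irrelevant. *)
Definition gfun := forall n : nat, mtuple R d n.+1 -> grop H n.+1.

Definition gdsum (m n : nat) (A : grop H m) (B : grop H n) : grop H (m + n) :=
  block_mx A 0 0 B.

(* (S (x) id_H) A *)
Definition gmull (n : nat) (S : 'M[R[i]]_n) (A : grop H n) : grop H n :=
  \matrix_(i, j) \sum_k S i k *: A k j.

(* A S *)
Definition gmulr (n : nat) (A : grop H n) (S : 'M[R[i]]_n) : grop H n :=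
  \matrix_(i, j) \sum_k S k j *: A i k.

Lemma gapp_gmulr (n : nat) (A : grop H n) (S : 'M[R[i]]_n) v :
  gapp (gmulr A S) v = gapp A (S *m v).
Proof.
apply/matrixP => i j; rewrite !mxE.
under eq_bigr do rewrite mxE scaler_sumr.
rewrite exchange_big; apply: eq_bigr => k _; rewrite mxE scaler_suml.
by apply: eq_bigr => l _; rewrite scalerA mulrC.
Qed.

Lemma gapp_gmull (n : nat) (A : grop H n) (S : 'M[R[i]]_n) v :
  gapp (gmull S A) v = \col_i \sum_k S i k *: gapp A v k 0.
Proof.
apply/matrixP => i j; rewrite !mxE.
under eq_bigr do rewrite mxE scaler_sumr.
rewrite exchange_big; apply: eq_bigr => k _; rewrite mxE scaler_sumr.
by apply: eq_bigr => l _; rewrite !scalerA mulrC.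
Qed.

Definition nc_function (E : set (Md R d)) (f : gfun) : Prop :=
  (forall (m n : nat) (x : mtuple R d m.+1) (y : mtuple R d n.+1),
     E (pt x) -> E (pt y) -> E (@pt R d (m + n.+1) (dsum x y)) ->
     f (m + n.+1)%N (dsum x y) = gdsum (f m x) (f n y)) /\
  (forall (n : nat) (S : 'M[R[i]]_n.+1) (x : mtuple R d n.+1),
     S \in unitmx -> E (pt x) -> E (pt (conj_tuple S x)) ->
     f n (conj_tuple S x) = gmulr (gmull S (f n x)) (invmx S)).

Definition tau_locally_bounded tau Omega (f : gfun) : Prop :=
  forall p, Omega p -> exists B, [/\ tau B, B p, B `<=` Omega
    & exists M : R, forall n (y : mtuple R d n.+1),
        B (pt y) -> `|f n y| <= M%:C].

Definition tau_locally_uniformly_bounded tau Omega (u : nat -> gfun) : Prop :=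
  forall p, Omega p -> exists B, [/\ tau B, B p, B `<=` Omega
    & exists M : R, forall k n (y : mtuple R d n.+1),
        B (pt y) -> `|u k n y| <= M%:C].

Definition Hol_tau tau Omega (f : gfun) : Prop :=
  nc_function Omega f /\ tau_locally_bounded tau Omega f.

(* Differentiability is over the field R[i], hence complex. *)
Definition Hol Omega (f : gfun) : Prop :=
  forall n (x : mtuple R d n.+1), slice Omega n x -> differentiable (f n) x.

(* Convergence of a sequence in the space Hol Omega, which includes membership
   of all terms and of the limit. *)
Definition cvg_Hol Omega (f : nat -> gfun) (g : gfun) : Prop :=
  [/\ forall l, Hol Omega (f l), Hol Omega g
    & forall K, finitely_compact K -> K `<=` Omega ->
      forall e : R, 0 < e -> \forall l \near \oo,
        forall n (x : mtuple R d n.+1), K (pt x) -> `|f l n x - g n x| < e%:C].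

Definition unitary (dot : {dot H for Num.conj}) (U : {linear H -> H}) : Prop :=
  (forall x y, dot (U x) (U y) = dot x y) /\ (forall y, exists x, U x = y).

Definition gact (U : {linear H -> H}) (f : gfun) : gfun :=
  fun n x => map_mx U (f n x).
End GradedFunctions.

Arguments gfun : clear implicits.

(* Main.v *)
(* Bounded vectors in an infinite-dimensional space need not subconverge, but
   unitaries can first rotate them into fixed finite-dimensional subspaces.
   List the entries of u^k at the rational points of Omega as vectors x(s,k).
   With e_0, e_1, ... a maximal orthonormal sequence, a product of reflections
   (a QR factorization) gives a unitary U^k taking x(s,k) into span(e_0, ..., e_s)
   for all s < k; limits along an ultrafilter then provide a single subsequence
   along which every U^k x(s,k) converges.

   Local uniform boundedness gives local equi-Lipschitz bounds at each level:
   for f bounded on an nc-domain, similarity by [[1, c], [0, 1]] yields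
   f([[y, c(z-y)], [0, z]]) = [[f(y), c(f(z)-f(y))], [0, f(z)]], and c can be taken
   of size 1/|z-y|.  Hence convergence at rational points propagates to all of
   Omega, uniformly on compact sets.  The same identity, applied one level up,
   shows that f is complex differentiable, so that Hol needs no Cauchy theory. *)

Require Import Defs.
From HB Require Import structures.
From mathcomp Require Import all_boot all_order all_algebra.
From mathcomp Require Import all_classical all_reals all_analysis.
From mathcomp Require Import complex sesquilinear ring lra.

Set Implicit Arguments.
Unset Strict Implicit.
Unset Printing Implicit Defensive.

Import Order.TTheory GRing.Theory Num.Theory.
Import numFieldNormedType.Exports.

Local Open Scope classical_set_scope.
Local Open Scope ring_scope.
Local Open Scope complex_scope.

(** * Reflections and triangularization by unitaries *)

Section Reflection.
Context {C : numClosedFieldType} {V : lmodType C} (dot : {dot V for Num.conj}).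
Implicit Types (w x y : V).

Lemma dot_conj x y : dot x y = Num.conj (dot y x).
Proof. by rewrite hermC expr0 mul1r. Qed.

Definition reflection w x : V := x - (2 * dot x w / dot w w) *: w.

Lemma reflection_is_linear w : linear (reflection w).
Proof.
move=> a x y; rewrite /reflection (linearDl dot) (linearZl_LR dot) /= mulrDr mulrDl scalerDl.
rewrite scalerBr opprD addrACA scalerA; congr (_ - _ *: _ + _); by ring.
Qed.

HB.instance Definition _ w :=
  GRing.isLinear.Build C V V *:%R (reflection w) (reflection_is_linear w).

Lemma dot_reflection w x y : dot (reflection w x) (reflection w y) = dot x y.
Proof.
have [->|w0] := eqVneq w 0; first by rewrite /reflection !scaler0 !subr0.
have N0 : dot w w != 0 by rewrite dnorm_eq0.
rewrite /reflection (linearBl dot) !(linearBr dot) !(linearZl_LR dot) !(linearZr_LR dot) /=.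
rewrite !rmorphM/= !fmorphV/= -!dot_conj rmorph_nat.
by field.
Qed.

Lemma reflectionK w : involutive (reflection w).
Proof.
move=> x; have [->|w0] := eqVneq w 0; first by rewrite /reflection !scaler0 !subr0.
have N0 : dot w w != 0 by rewrite dnorm_eq0.
rewrite /reflection (linearBl dot) (linearZl_LR dot) /= -addrA -opprD -scalerDl.
rewrite [X in X *: _](_ : _ = 0) ?scale0r ?subr0 //; by field.
Qed.

Lemma reflection_orthogonal w x : dot x w = 0 -> reflection w x = x.
Proof. by move=> xw; rewrite /reflection xw mulr0 mul0r scale0r subr0. Qed.

(** Equal lengths and, over the complex field, a real inner product: then [dot w w = 2 * dot x w]
    for [w = x - y], and subtracting [w] from [x] leaves [y]. *)
Lemma reflection_sub x y : dot x x = dot y y -> dot x y = dot y x ->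
  reflection (x - y) x = y.
Proof.
move=> xx xy; have [/eqP|w0] := eqVneq (x - y) 0.
  by rewrite subr_eq0 => /eqP ->; rewrite /reflection subrr scaler0 subr0.
have : dot (x - y) (x - y) != 0 by rewrite dnorm_eq0.
rewrite /reflection (linearBl dot) !(linearBr dot)/= -xx xy.
have -> : dot x x - dot y x - (dot y x - dot x x) = 2 * (dot x x - dot y x) by ring.
by move=> N0; rewrite divff // scale1r opprB addrCA subrr addr0.
Qed.

(** Reflect along [w = x - c *: e], with the modulus of [c] the length of [x] and its phase chosen
    to make [dot x (c *: e)] real. A vector orthogonal to [x] and [e] is orthogonal to [w], hence
    fixed. *)
Lemma reflection_onto_line x e : dot e e = 1 ->
  exists w c, [/\ reflection w x = c *: e
    & forall y, dot y x = 0 -> dot y e = 0 -> reflection w y = y].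
Proof.
move=> ee1.
suff [c [cc ce]] : exists c : C,
    dot x x = c * Num.conj c /\ Num.conj c * dot x e = c * dot e x.
  exists (x - c *: e), c; split.
    by apply: reflection_sub; rewrite ?(linearZl_LR dot) (linearZr_LR dot)/= ?ee1 ?mulr1.
  move=> y yx ye; apply: reflection_orthogonal.
  by rewrite (linearBr dot) (linearZr_LR dot)/= yx ye mulr0 subrr.
have sx : Num.conj (sqrtC (dot x x)) = sqrtC (dot x x).
  by apply: conj_Creal; rewrite ger0_real // sqrt_dnorm_ge0.
have sqx : sqrtC (dot x x) * sqrtC (dot x x) = dot x x by rewrite -expr2 sqrtCK.
(* For [dot x e = 0] any phase works; otherwise take that of [dot x e]. *)
rewrite (dot_conj e x); have [->|z0] := eqVneq (dot x e) 0.
  by exists (sqrtC (dot x x)); rewrite sx sqx conjC0 !mulr0.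
exists (sqrtC (dot x x) * (dot x e / `|dot x e|)).
have n0 : `|dot x e| != 0 by rewrite normr_eq0.
rewrite !rmorphM/= fmorphV/= conj_normC sx.
have zz := normCK (dot x e); split; last by ring.
have -> (a b z n : C) : a * (z / n) * (a * (b / n)) = a * a * (z * b) / (n * n).
  by rewrite invfM; ring.
by rewrite sqx -zz expr2 mulfK // mulf_neq0.
Qed.

End Reflection.

(** * Maximal orthonormal sequences *)

Section Triangularization.
Context {C : numClosedFieldType} {V : lmodType C} (dot : {dot V for Num.conj}).
Implicit Types (x y : V) (e : nat -> V).

(* A maximal orthonormal sequence; when V is finite-dimensional it is padded
   with zeros. *)
Definition gs_basis e := forall j,
  (forall i, (i < j)%N -> dot (e j) (e i) = 0) /\
  (dot (e j) (e j) = 1 \/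
   e j = 0 /\ forall x, (forall i, (i < j)%N -> dot x (e i) = 0) -> x = 0).

(** Greedy choice: [next] takes a unit vector orthogonal to the earlier choices, with default 0.
    When the default occurs, a nonzero vector orthogonal to them could be normalized and chosen, so
    there is none. *)
Lemma exists_gs_basis : exists e, gs_basis e.
Proof.
pose next (S : set V) := xget 0 [set x | dot x x = 1 /\ forall y, S y -> dot x y = 0].
pose prev := fix prev j : set V := if j is j'.+1 then prev j' `|` [set next (prev j')] else set0.
have prevP j i : (i < j)%N -> prev j (next (prev i)).
  elim: j => // j IH; rewrite ltnS leq_eqVlt => /orP[/eqP ->|/IH]; first by right.
  by left.
have prevE j y : prev j y -> exists2 i, (i < j)%N & y = next (prev i).
  elim: j => // j IH [/IH[i ij ->]|->]; last by exists j.
  by exists i => //; exact: ltnW.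
exists (fun j => next (prev j)) => j.
rewrite {1 3 4 5}/next; case: xgetP => [x _ [xx xS]|none].
  by split; [move=> i ij; apply: xS; exact: prevP|left].
split; first by move=> i _; rewrite (linear0l dot).
right; split=> // x xe; apply: contrapT => /eqP x0.
have nx0 : dot x x != 0 by rewrite dnorm_eq0.
apply: (none ((sqrtC (dot x x))^-1 *: x)); split.
  have s0 : 0 <= sqrtC (dot x x) by exact: sqrt_dnorm_ge0.
  by rewrite dnormZ normfV exprVn (ger0_norm s0) sqrtCK mulVf.
move=> y /prevE[i ij ->]; rewrite (linearZl_LR dot) -[RHS](mulr0 (sqrtC (dot x x))^-1).
by congr (_ * _); exact: xe.
Qed.

Definition gs_span e j x := exists c : nat -> C, x = \sum_(i < j) c i *: e i.

Lemma gs_dot e i j : gs_basis e -> i != j -> dot (e i) (e j) = 0.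
Proof.
move=> ge; rewrite neq_ltn => /orP[ij|ji]; last by have [/(_ _ ji)] := ge i.
by rewrite dot_conj; have [/(_ _ ij) -> _] := ge j; rewrite conjC0.
Qed.

Lemma gs_dotZ e i : gs_basis e -> dot (e i) (e i) *: e i = e i.
Proof. by move=> /(_ i)[_ [->|[-> _]]]; rewrite ?scale1r ?scaler0. Qed.

Lemma gs_span_dotE e j x : gs_basis e -> gs_span e j x ->
  x = \sum_(i < j) dot x (e i) *: e i.
Proof.
move=> ge [c ->]; apply: eq_bigr => i _; rewrite (linear_sumlz dot).
rewrite (bigD1 i) //= big1 ?addr0 => [|k ki].
  by rewrite (linearZl_LR dot)/= -scalerA gs_dotZ.
by rewrite (linearZl_LR dot)/= gs_dot // mulr0.
Qed.

Lemma gs_residual e j x i : gs_basis e -> (i < j)%N ->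
  dot (x - \sum_(k < j) dot x (e k) *: e k) (e i) = 0.
Proof.
move=> ge ij; rewrite (linearBl dot) (linear_sumlz dot) (bigD1 (Ordinal ij)) //=.
rewrite big1 ?addr0 => [|k ki]; last by rewrite (linearZl_LR dot)/= gs_dot // mulr0.
rewrite (linearZl_LR dot)/=.
by have [_ [->|[-> _]]] := ge i; rewrite ?mulr1 ?(linear0r dot) ?mul0r subrr.
Qed.

End Triangularization.

Section UnitaryTriangularization.
Context {R : realType} {H : completeNormedModType R[i]}.
Variable dot : {dot H for Num.conj}.

Lemma unitary_id : unitary dot (idfun : {linear H -> H}).
Proof. by split=> // y; exists y. Qed.

Lemma unitary_comp (U W : {linear H -> H}) :
  unitary dot U -> unitary dot W -> unitary dot (U \o W : {linear H -> H}).
Proof.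
move=> [Ud Us] [Wd Ws]; split=> [x y|y]; first by rewrite Ud Wd.
by have [x <-] := Us y; have [z <-] := Ws x; exists z.
Qed.

Lemma unitary_reflection w : unitary dot (reflection dot w : {linear H -> H}).
Proof.
split=> [x y|y]; first exact: dot_reflection.
by exists (reflection dot w y); exact: reflectionK.
Qed.

(** Write [x = p + a] with [p] the projection to the span of the first [j] vectors, and reflect the
    residual [a] onto the line of [e j]. Each [e i] with [i < j] is orthogonal to [a] and [e j], so
    it and [p] stay fixed. *)
Lemma unitary_step e j x : gs_basis dot e ->
  exists U : {linear H -> H}, [/\ unitary dot U,
    forall i, (i < j)%N -> U (e i) = e i & gs_span e j.+1 (U x)].
Proof.
move=> ge; set p := \sum_(k < j) dot x (e k) *: e k; pose a := x - p.
have xE : x = p + a by rewrite addrC subrK.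
have ae i : (i < j)%N -> dot a (e i) = 0 by exact: gs_residual.
have [ej [ee|[ej0 ejx]]] := ge j; last first.
  (* A padding zero at [j] forces [a = 0] by maximality, so [x] already lies in the span. *)
  exists idfun; split=> //; first exact: unitary_id.
  exists (fun k => dot x (e k)); rewrite big_ord_recr /= ej0 scaler0 addr0.
  by rewrite {1}xE (ejx a) // addr0.
have [w [c [wa wfix]]] := reflection_onto_line a ee.
have wei i : (i < j)%N -> reflection dot w (e i) = e i.
  move=> ij; apply: wfix; rewrite dot_conj ?ae ?ej ?conjC0 //.
exists (reflection dot w); split=> //; first exact: unitary_reflection.
exists (fun k => if k == j then c else dot x (e k)).
rewrite big_ord_recr /= eqxx {1}xE linearD /= wa; congr (_ + _).
rewrite linear_sum; apply: eq_bigr => i _.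
by rewrite linearZ /= wei // (ltn_eqF (ltn_ord i)).
Qed.

(** The step for [x m] fixes every [e i] with [i < m], hence all images already placed in their
    spans. *)
Lemma unitary_triangularization e (x : nat -> H) m : gs_basis dot e ->
  exists U : {linear H -> H},
    unitary dot U /\ forall s, (s < m)%N -> gs_span e s.+1 (U (x s)).
Proof.
move=> ge; elim: m => [|m [U [Uu Us]]].
  by exists idfun; split=> //; exact: unitary_id.
have [W [Wu We Wx]] := unitary_step m (U (x m)) ge.
exists (W \o U); split=> [|s]; first exact: unitary_comp.
rewrite ltnS leq_eqVlt => /orP[/eqP ->//|sm] /=.
have [c ->] := Us s sm; exists c; rewrite linear_sum; apply: eq_bigr => i _.
by rewrite linearZ/= We // (leq_ltn_trans _ sm) // -ltnS.
Qed.

End UnitaryTriangularization.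

(** * Subsequences convergent up to unitaries *)

Section RealNorm.
Context {R : realType}.

(** Norms here take values in [R[i]]; their real part moves estimates into the ordered field [R]. *)
Definition rnorm (V : normedZmodType R[i]) (x : V) : R := complex.Re `|x|.

Lemma rnormE (V : normedZmodType R[i]) (x : V) : `|x| = (rnorm x)%:C.
Proof.
rewrite /rnorm; have := normr_ge0 x.
by case: `|x| => a b; rewrite lecE /= => /andP[/eqP -> _].
Qed.

Lemma rnorm_ge0 (V : normedZmodType R[i]) (x : V) : 0 <= rnorm x.
Proof. by rewrite -lecR -rnormE normr_ge0. Qed.

Lemma rnorm0 (V : normedZmodType R[i]) : rnorm (0 : V) = 0.
Proof. by rewrite /rnorm normr0. Qed.

Lemma rnorm0_eq0 (V : normedZmodType R[i]) (x : V) : rnorm x = 0 -> x = 0.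
Proof. by move=> x0; apply: normr0_eq0; rewrite rnormE x0. Qed.

Lemma rnormD (V : normedZmodType R[i]) (x y : V) : rnorm (x + y) <= rnorm x + rnorm y.
Proof. by rewrite -lecR rmorphD /= -!rnormE ler_normD. Qed.

Lemma rnorm_distC (V : normedZmodType R[i]) (x y : V) : rnorm (x - y) = rnorm (y - x).
Proof. by rewrite /rnorm distrC. Qed.

Lemma rnorm_distD (V : normedZmodType R[i]) (z x y : V) :
  rnorm (x - y) <= rnorm (x - z) + rnorm (z - y).
Proof. by apply: le_trans (rnormD _ _); rewrite addrA subrK. Qed.

Lemma rnorm_sum (V : normedZmodType R[i]) (I : finType) (F : I -> V) :
  rnorm (\sum_i F i) <= \sum_i rnorm (F i).
Proof.
apply: (big_ind2 (fun x r => rnorm x <= r)) => // [|x r y s xr ys]; first by rewrite rnorm0.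
by apply: le_trans (rnormD _ _) _; exact: lerD.
Qed.

Lemma rnormZ (V : normedModType R[i]) (c : R[i]) (x : V) :
  rnorm (c *: x) = rnorm c * rnorm x.
Proof. by apply: complexI; rewrite rmorphM /= -!rnormE normrZ. Qed.

Lemma rnormM (c e : R[i]) : rnorm (c * e) = rnorm c * rnorm e.
Proof. by apply: complexI; rewrite rmorphM /= -!rnormE normrM. Qed.

Lemma rnormV (c : R[i]) : rnorm c^-1 = (rnorm c)^-1.
Proof. by apply: complexI; rewrite fmorphV /= -!rnormE normfV. Qed.

Lemma rnorm_real (r : R) : rnorm (r%:C) = `|r|.
Proof. by rewrite /rnorm normc_def /= expr0n addr0 sqrtr_sqr. Qed.

Lemma rnorm_le (V : normedZmodType R[i]) (x : V) (r : R) :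
  (`|x| <= r%:C) = (rnorm x <= r).
Proof. by rewrite rnormE lecR. Qed.

Lemma rnorm_lt (V : normedZmodType R[i]) (x : V) (r : R) :
  (`|x| < r%:C) = (rnorm x < r).
Proof. by rewrite rnormE ltcR. Qed.

Lemma complex_gt0_real (e : R[i]) : 0 < e -> exists2 r : R, 0 < r & e = r%:C.
Proof.
by case: e => a b; rewrite ltcE /= => /andP[/eqP -> a0]; exists a.
Qed.

Lemma nbhs_rnormP (V : normedModType R[i]) (x : V) (P : set V) :
  nbhs x P <-> exists2 e : R, 0 < e & forall y, rnorm (y - x) < e -> P y.
Proof.
split=> [/nbhs_ballP[_ /= /complex_gt0_real[e e0 ->] xP]|[e e0 xP]].
  exists e => // y yx; apply: xP; rewrite -ball_normE /=.
  by rewrite rnorm_lt rnorm_distC.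
apply/nbhs_ballP; exists (e%:C); first by rewrite /= ltcR.
by move=> y; rewrite -ball_normE /= rnorm_lt rnorm_distC; exact: xP.
Qed.

Lemma cvg_rnormP (V : normedModType R[i]) (T : Type) (F : set_system T) (FF : Filter F)
    (f : T -> V) (y : V) :
  f @ F --> y <-> forall e : R, 0 < e -> \forall t \near F, rnorm (f t - y) < e.
Proof.
split=> [fy e e0|fy P /nbhs_rnormP[e e0 yP]].
  by apply: (fy [set z | rnorm (z - y) < e]); apply/nbhs_rnormP; exists e.
by apply: filterS (fy e e0) => t; exact: yP.
Qed.

Lemma rnorm_cvg_le (V : normedModType R[i]) (T : Type) (F : set_system T)
    (FF : ProperFilter F) (f : T -> V) (y : V) (M : R) :
  f @ F --> y -> (\forall t \near F, rnorm (f t) <= M) -> rnorm y <= M.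
Proof.
move=> /cvg_rnormP fy fM; apply/ler_addgt0Pr => e e0.
have [t [ft fe]] := filter_ex (filterI fM (fy e e0)).
rewrite -(subrK (f t) y); apply: le_trans (rnormD _ _) _.
by rewrite addrC rnorm_distC lerD // ltW.
Qed.

End RealNorm.

(** * Limits along ultrafilters *)

Section Ultralimits.
Context {R : realType} (G : set_system nat) {GU : UltraFilter G}.

(** Compactness gives a cluster point. For an ultrafilter it is a limit: the preimage of a
    neighbourhood or its complement lies in [G], and clustering excludes the complement. *)
Lemma ultra_cvg_real (a : nat -> R) (M : R) : (forall k, `|a k| <= M) ->
  exists l : R, a @ G --> l.
Proof.
move=> aM.
have aG : (a @ G) `[- M, M]%classic.
  by apply: (@filterE _ G) => k /=; rewrite in_itv /= -ler_norml.
have [l [_ al]] := segment_compact (fmap_proper_filter a _) aG.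
exists l => B lB; have [//|GaB] := in_ultra_setVsetC (a @^-1` B) GU.
by have [z []] := al (~` B) B GaB lB.
Qed.

Lemma ultra_cvg_complex (a : nat -> R[i]) (M : R) : (forall k, rnorm (a k) <= M) ->
  exists l : R[i], forall e : R, 0 < e -> \forall k \near G, rnorm (a k - l) < e.
Proof.
move=> aM.
have Re_le (z : R[i]) : `|complex.Re z| <= rnorm z.
  by rewrite -lecR -rnormE normc_ge_Re.
have Im_le (z : R[i]) : `|complex.Im z| <= rnorm z.
  by rewrite -sqrtr_sqr /rnorm normc_def /= ler_wsqrtr // lerDr sqr_ge0.
have le_ReIm (z : R[i]) : rnorm z <= `|complex.Re z| + `|complex.Im z|.
  rewrite {1}[z]complexE; apply: le_trans (rnormD _ _) _.
  rewrite rnormM !rnorm_real lerD2l -[leRHS]mul1r ler_wpM2r //.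
  by rewrite /rnorm normc_def /= expr0n expr1n add0r sqrtr1.
have [p ap] := ultra_cvg_real (fun k => le_trans (Re_le (a k)) (aM k)).
have [q aq] := ultra_cvg_real (fun k => le_trans (Im_le (a k)) (aM k)).
exists (p +i* q) => e e0.
have e20 : 0 < e / 2 by rewrite divr_gt0.
move/cvgrPdist_lt : ap => /(_ _ e20) ap; move/cvgrPdist_lt : aq => /(_ _ e20) aq.
apply: filterS2 ap aq => k ap aq; apply: le_lt_trans (le_ReIm _) _.
rewrite !raddfB /= -(distrC p) -(distrC q) [e]splitr; exact: ltrD.
Qed.

(** In a fixed finite-dimensional span only finitely many coordinates [dot (x k) (e i)] occur, each
    bounded by [M] and hence convergent along [G]. *)
Lemma ultra_cvg_gs_span (H : completeNormedModType R[i]) (dot : {dot H for Num.conj})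
    (dot_norm : forall x : H, dot x x = `|x| ^+ 2) (e : nat -> H) (j : nat)
    (x : nat -> H) (M : R) : gs_basis dot e ->
  (forall k, rnorm (x k) <= M) -> (\forall k \near G, gs_span e j (x k)) ->
  exists y : H, x @ G --> y.
Proof.
move=> ge xM xe.
have e1 i : rnorm (e i) <= 1.
  have := dot_norm (e i); have [_ [->|[-> _]]] := ge i; last by rewrite rnorm0.
  rewrite rnormE -rmorphXn /= => /complexI/eqP.
  by rewrite eq_sym sqrp_eq1 ?rnorm_ge0 // => /eqP ->.
have dot_le i k : rnorm (dot (x k) (e i)) <= M.
  (* |<x, e>|^2 <= |x|^2 follows from <x - <x,e>e, x - <x,e>e> >= 0 *)
  apply: le_trans (xM k).
  have := dnorm_ge0 dot (x k - dot (x k) (e i) *: e i).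
  rewrite dnormB dnormZ (linearZr_LR dot)/= -normCKC.
  have [_ [->|[-> _]]] := ge i; last first.
    by rewrite (linear0r dot) rnorm0 rnorm_ge0.
  rewrite mulr1 conj_Creal ?ger0_real ?exprn_ge0 // opprD addrA addrK.
  rewrite dot_norm subr_ge0 !rnormE -!rmorphXn /= lecR.
  by rewrite ler_sqr ?nnegrE ?rnorm_ge0.
have /choice[c cP] : forall i, exists l : R[i], forall r : R, 0 < r ->
    \forall k \near G, rnorm (dot (x k) (e i) - l) < r.
  by move=> i; exact: ultra_cvg_complex (dot_le i).
exists (\sum_(i < j) c i *: e i); apply/cvg_rnormP => r r0.
(* Dividing by [j.+1] makes the sum of [j] errors strictly smaller than [r], also for [j = 0]. *)
have rj0 : 0 < r / j.+1%:R by rewrite divr_gt0 // ltr0n.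
have : \forall k \near G, forall i : 'I_j, rnorm (dot (x k) (e i) - c i) < r / j.+1%:R.
  by apply: filter_forall => i; exact: cP.
apply: filterS2 xe => k xe ck.
rewrite [x k](gs_span_dotE ge xe) -sumrB.
apply: le_lt_trans (rnorm_sum _) _.
apply: (@le_lt_trans _ _ (\sum_(i < j) r / j.+1%:R)).
  apply: ler_sum => i _; rewrite -scalerBl rnormZ; have := ck i => /ltW cki.
  by rewrite -[leRHS]mulr1 ler_pM ?rnorm_ge0.
rewrite sumr_const card_ord -[ltLHS]mulr_natr mulrAC ltr_pdivrMr ?ltr0n //.
by rewrite ltr_pM2l // ltr_nat.
Qed.

End Ultralimits.

(** Sets of [G] meet every tail, so [kl l] can be picked in [P l] beyond its predecessor. This turns
    limits along an ultrafilter into limits along a subsequence. *)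
Lemma subsequence_of_filter (G : set_system nat) (GP : ProperFilter G) (P : nat -> set nat) :
  \oo `<=` G -> (forall l, G (P l)) ->
  exists kl : nat -> nat, {homo kl : l m / (l < m)%N} /\ forall l, P l (kl l).
Proof.
move=> ooG GPl.
have nextP l m : exists k, (m < k)%N /\ P l k.
  have [k [mk Pk]] := filter_ex (filterI (ooG _ (nbhs_infty_gt m)) (GPl l)).
  by exists k.
pose kl := fix kl l := if l is l'.+1 then projT1 (cid (nextP l (kl l')))
                       else projT1 (cid (nextP 0%N 0%N)).
exists kl; split; last by case=> [|l] /=; case: cid => k [].
apply: homo_ltn; first exact: ltn_trans.
by move=> l /=; case: cid => k [].
Qed.

Lemma rnorm_unitary (R : realType) (H : completeNormedModType R[i])
    (dot : {dot H for Num.conj}) (dot_norm : forall x : H, dot x x = `|x| ^+ 2)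
    (U : {linear H -> H}) : unitary dot U -> forall x, rnorm (U x) = rnorm x.
Proof.
move=> [Ud _] x; have := Ud x x; rewrite !dot_norm !rnormE -!rmorphXn /=.
by move=> /complexI/eqP; rewrite eqrXn2 ?rnorm_ge0 // => /eqP.
Qed.

(** A single ultrafilter serves all rows [s] at once, in place of a diagonal argument over
    subsequences. *)
Lemma unitary_bolzano_weierstrass (R : realType) (H : completeNormedModType R[i])
    (dot : {dot H for Num.conj}) (dot_norm : forall x : H, dot x x = `|x| ^+ 2)
    (x : nat -> nat -> H) (M : nat -> R) : (forall s k, rnorm (x s k) <= M s) ->
  exists (U : nat -> {linear H -> H}) (kl : nat -> nat) (y : nat -> H),
    [/\ forall k, unitary dot (U k), {homo kl : l m / (l < m)%N} &
      forall s, U (kl l) (x s (kl l)) @[l --> \oo] --> y s].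
Proof.
move=> xM.
have [e ge] := exists_gs_basis dot.
have /choice[U UP] := fun k => unitary_triangularization (fun s => x s k) k ge.
have Un k z : rnorm (U k z) = rnorm z.
  by have [Uu _] := UP k; exact: rnorm_unitary Uu z.
have [G [GU ooG]] := @ultraFilterLemma nat \oo _.
have /choice[y yP] : forall s, exists z : H, U k (x s k) @[k --> G] --> z.
  move=> s; apply: (ultra_cvg_gs_span dot_norm (M := M s) (j := s.+1) ge) => [k|].
    by rewrite Un.
  (* [U k] controls row [s] only when [s < k]; these [k] form a tail, which [G] contains. *)
  apply: ooG; exists s.+1 => // k /= sk; have [_] := UP k; exact.
(* [P l] constrains only the first [l.+1] rows, so it is a finite intersection of sets of [G]; every
   fixed row is eventually among them. *)
pose P l := [set k | forall s : 'I_l.+1, rnorm (U k (x s k) - y s) < l.+1%:R^-1].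
have GPl l : G (P l).
  apply: filter_forall => s; apply: (proj1 (cvg_rnormP _ _ _) (yP s)).
  by rewrite invr_gt0 ltr0n.
have [kl [kl_homo klP]] := subsequence_of_filter _ ooG GPl.
exists U, kl, y; split=> // [k|s]; first by have [] := UP k.
apply/cvg_rnormP => r r0.
near=> l; have sl : (s < l.+1)%N by near: l; exists s.
apply: lt_trans (klP l (Ordinal sl)) _.
near: l; exact: near_infty_natSinv_lt (PosNum r0).
Unshelve. all: by end_near. Qed.

(** * Differentiability from a Lipschitz difference-differential *)

Section DifferenceDifferential.
Context {R : realType} {V W : normedModType R[i]}.
Variables (f : V -> W) (x : V) (D : V -> V -> V -> W) (r K : R).
Hypotheses (r0 : 0 < r) (K0 : 0 <= K).
Let near_x y := rnorm (y - x) < r.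
(** For an nc-function, [D y z h] is the upper right block of [f] at [[[y, h], [0, z]]]. It is tied
    to [f] only along multiples of [z - y]; linearity of [D x x] near 0 is derived from the
    Lipschitz bound. *)
Hypothesis DE : forall y z c, near_x y -> near_x z -> rnorm (c *: (z - y)) < r ->
  D y z (c *: (z - y)) = c *: (f z - f y).
Hypothesis D_lipschitz : forall y z y' z' h,
  near_x y -> near_x z -> near_x y' -> near_x z' -> rnorm h < r ->
  rnorm (D y z h - D y' z' h) <= K * (rnorm (y - y') + rnorm (z - z')).
Hypothesis D_lipschitz3 : forall h h', rnorm h < r -> rnorm h' < r ->
  rnorm (D x x h - D x x h') <= K * rnorm (h - h').

Let L0 h := D x x h.

Let near_xx : near_x x. Proof. by rewrite /near_x subrr rnorm0. Qed.

Let small_eq0 (w : W) (t0 k : R) : 0 < t0 ->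
  (forall t, 0 < t -> t < t0 -> rnorm w <= t * k) -> w = 0.
Proof.
move=> t00 wt; apply: rnorm0_eq0; apply/eqP; rewrite eq_le rnorm_ge0 andbT.
have k0 : 0 <= k.
  have t2 : 0 < t0 / 2 by rewrite divr_gt0.
  have := wt _ t2; rewrite ltr_pdivrMr // ltr_pMr // ltr1n => /(_ isT) wk.
  by rewrite -(pmulr_rge0 _ t2) (le_trans (rnorm_ge0 w)).
apply/ler_addgt0Pr => e e0; rewrite add0r.
pose t := Num.min (t0 / 2) (e / (k + 1)).
have k10 : 0 < k + 1 by rewrite ltr_wpDl.
have t_gt0 : 0 < t by rewrite lt_min !divr_gt0.
have tt0 : t < t0 by rewrite /t gt_min ltr_pdivrMr // ltr_pMr // ltr1n.
apply: le_trans (wt t t_gt0 tt0) _.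
have : t <= e / (k + 1) by rewrite /t ge_min lexx orbT.
rewrite ler_pdivlMr //; apply: le_trans.
by rewrite ler_pM2l // lerDl.
Qed.

Let rnorm_scale_real (t : R) (h : V) : 0 < t -> rnorm (t%:C *: h) = t * rnorm h.
Proof. by move=> t0; rewrite rnormZ rnorm_real gtr0_norm. Qed.

Let t_near (h : V) (k t : R) : rnorm h <= k -> 0 < t -> t < r / (k + 1) ->
  near_x (x + t%:C *: h).
Proof.
move=> hk t0; have k10 : 0 < k + 1 by rewrite ltr_wpDl // (le_trans (rnorm_ge0 h)).
rewrite ltr_pdivlMr // /near_x [x + _]addrC addrK rnorm_scale_real //; apply: le_lt_trans.
by rewrite ler_pM2l // (le_trans hk) // lerDl.
Qed.

(** With [y = x + t h] and [z = x + t (h + k)] the difference quotients telescope: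
    [D x z (h + k) = D x y h + D y z k]. Moving all base points to [x] costs O(t), for arbitrarily
    small [t]. *)
Let L0_additive h k : rnorm h < r -> rnorm k < r -> rnorm (h + k) < r ->
  L0 (h + k) = L0 h + L0 k.
Proof.
move=> hr kr hkr; apply/eqP; rewrite -subr_eq0; apply/eqP.
pose m := rnorm h + rnorm k.
have hm : rnorm h <= m by rewrite lerDl rnorm_ge0.
have hkm : rnorm (h + k) <= m by exact: rnormD.
have m10 : 0 < m + 1 by rewrite ltr_wpDl // (le_trans (rnorm_ge0 h)).
apply: (@small_eq0 _ (r / (m + 1)) (K * (rnorm (h + k) + rnorm h + (rnorm h + rnorm (h + k))))).
  by rewrite divr_gt0.
move=> t t0 tr.
have tC0 : t%:C != 0 by rewrite eq_complex /= negb_and gt_eqF.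
pose y := x + t%:C *: h; pose z := x + t%:C *: (h + k).
have ny : near_x y by exact: t_near hm t0 tr.
have nz : near_x z by exact: t_near hkm t0 tr.
have DtE a b l : near_x a -> near_x b -> rnorm l < r -> b - a = t%:C *: l ->
    D a b l = (t%:C)^-1 *: (f b - f a).
  move=> na nb lr ba; have lE : l = t%:C^-1 *: (b - a).
    by rewrite ba scalerA mulVf // scale1r.
  by rewrite {1}lE DE // -lE.
have xyE : D x y h = (t%:C)^-1 *: (f y - f x) by apply: DtE => //; rewrite /y [x + _]addrC addrK.
have xzE : D x z (h + k) = (t%:C)^-1 *: (f z - f x).
  by apply: DtE => //; rewrite /z [x + _]addrC addrK.
have yzE : D y z k = (t%:C)^-1 *: (f z - f y).
  by apply: DtE => //; rewrite /z /y scalerDr addrA [X in X - _]addrC addrK.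
have -> : L0 (h + k) - (L0 h + L0 k) =
    (D x x (h + k) - D x z (h + k)) + ((D x y h - D x x h) + (D y z k - D x x k)).
  rewrite (addrACA (D x y h)) -opprD xyE xzE yzE -scalerDr.
  by rewrite [_ + (f z - f y)]addrC subrKA subrKA.
apply: le_trans (rnormD _ _) _.
apply: le_trans (lerD (D_lipschitz near_xx near_xx near_xx nz hkr) (rnormD _ _)) _.
apply: le_trans (lerD (lexx _) (lerD (D_lipschitz near_xx ny near_xx near_xx hr)
  (D_lipschitz ny nz near_xx near_xx kr))) _.
rewrite !subrr !rnorm0 !add0r rnorm_distC /z /y ![x + _]addrC !addrK.
rewrite !rnorm_scale_real //; rewrite le_eqVlt; apply/orP; left; apply/eqP; ring.
Qed.

(** For nonzero [c] and [z = x + t c h], [D x z (c h) = c D x z h] exactly, both sides being the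
    same difference quotient; replacing [z] by [x] costs O(t). *)
Let L0_homogeneous c h : rnorm h < r -> rnorm (c *: h) < r -> L0 (c *: h) = c *: L0 h.
Proof.
move=> hr chr; have [->|c0] := eqVneq c 0.
  have := @DE x x 1 near_xx near_xx; rewrite subrr scaler0 rnorm0 => /(_ r0).
  by rewrite /L0 scale0r scale0r subrr scaler0.
apply/eqP; rewrite -subr_eq0; apply/eqP.
have m10 : 0 < rnorm (c *: h) + 1 by rewrite ltr_wpDl // rnorm_ge0.
apply: (@small_eq0 _ (r / (rnorm (c *: h) + 1))
  (K * rnorm (c *: h) + rnorm c * (K * rnorm (c *: h)))).
  by rewrite divr_gt0.
move=> t t0 tr; have tC0 : t%:C != 0 by rewrite eq_complex /= negb_and gt_eqF.
pose z := x + t%:C *: (c *: h).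
have nz : near_x z by exact: t_near (lexx _) t0 tr.
have zx : z - x = t%:C *: (c *: h) by rewrite /z [x + _]addrC addrK.
have E1 : D x z (c *: h) = t%:C^-1 *: (f z - f x).
  have lE : c *: h = t%:C^-1 *: (z - x) by rewrite zx scalerA mulVf // scale1r.
  by rewrite {1}lE DE // -lE.
have E2 : D x z h = (t%:C * c)^-1 *: (f z - f x).
  have lE : h = (t%:C * c)^-1 *: (z - x).
    by rewrite zx (scalerA t%:C c) scalerA mulVf ?scale1r // mulf_neq0.
  by rewrite {1}lE DE // -lE.
have -> : L0 (c *: h) - c *: L0 h =
    (D x x (c *: h) - D x z (c *: h)) + c *: (D x z h - D x x h).
  by rewrite E1 E2 (scalerBr c) (scalerA c) invfM mulrCA divff // mulr1 subrKA.
apply: le_trans (rnormD _ _) _; rewrite rnormZ mulrDr !(mulrCA t).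
have xz : rnorm (x - z) = t * rnorm (c *: h).
  by rewrite rnorm_distC zx rnorm_scale_real.
apply: lerD; last apply: ler_wpM2l; rewrite ?rnorm_ge0 //.
  apply: le_trans (D_lipschitz near_xx near_xx near_xx nz chr) _.
  by rewrite subrr rnorm0 add0r xz.
apply: le_trans (D_lipschitz near_xx nz near_xx near_xx hr) _.
by rewrite subrr rnorm0 add0r rnorm_distC xz.
Qed.

Let rad (h : V) : R := r / (rnorm h + 1) / 2.

Let rad_gt0 (h : V) : 0 < rad h.
Proof. by rewrite !divr_gt0 // ltr_wpDl // rnorm_ge0. Qed.

Let rad_lt h (t : R) : 0 < t -> t <= rad h -> rnorm (t%:C *: h) < r.
Proof.
move=> t0 th; have m10 : 0 < rnorm h + 1 by rewrite ltr_wpDl // rnorm_ge0.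
have {th} : t < r / (rnorm h + 1).
  by apply: le_lt_trans th _; rewrite ltr_pdivrMr // ltr_pMr ?divr_gt0 // ltr1n.
by move/(t_near (lexx _) t0); rewrite /near_x [x + _]addrC addrK.
Qed.

(** [L0] is controlled only on the ball of radius [r]; [L] extends it to all of [V] by scaling [h]
    into the ball and back. *)
Let L h := ((rad h)%:C)^-1 *: L0 ((rad h)%:C *: h).

Let realC_neq0 (t : R) : 0 < t -> t%:C != 0.
Proof. by move=> t0; rewrite eq_complex /= negb_and gt_eqF. Qed.

Let LE h c : c != 0 -> rnorm (c *: h) < r -> L h = c^-1 *: L0 (c *: h).
Proof.
move=> c0 ch; have s0 := realC_neq0 (rad_gt0 h).
have -> : c *: h = (c / (rad h)%:C) *: ((rad h)%:C *: h) by rewrite scalerA divfK.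
rewrite L0_homogeneous ?scalerA ?divfK //; last exact: rad_lt.
by rewrite mulKf.
Qed.

Let L_linear : linear L.
Proof.
move=> a h k.
pose t := Num.min (Num.min (rad h) (rad (a *: h))) (Num.min (rad k) (rad (a *: h + k))).
have t0 : 0 < t by rewrite !lt_min !rad_gt0.
have [th [tah [tk tahk]]] : t <= rad h /\ t <= rad (a *: h) /\ t <= rad k /\
    t <= rad (a *: h + k) by rewrite /t !ge_min !lexx !orbT.
have tC0 := realC_neq0 t0.
have tS l : t <= rad l -> rnorm (t%:C *: l) < r by move=> tl; exact: rad_lt.
rewrite (LE tC0 (tS _ tahk)) (LE tC0 (tS _ th)) (LE tC0 (tS _ tk)).
have E : t%:C *: (a *: h) = a *: (t%:C *: h) by rewrite !scalerA mulrC.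
have -> : L0 (t%:C *: (a *: h + k)) = a *: L0 (t%:C *: h) + L0 (t%:C *: k).
  rewrite scalerDr L0_additive ?tS //; last by rewrite -scalerDr tS.
  by rewrite E L0_homogeneous ?tS // -E tS.
by rewrite scalerDr !scalerA mulrC.
Qed.

Let L_bounded h : rnorm (L h) <= K * rnorm h.
Proof.
have s0 := rad_gt0 h; have sC0 := realC_neq0 s0.
rewrite /L rnormZ rnormV rnorm_real gtr0_norm // mulrC ler_pdivrMr //.
have L00 : L0 0 = 0.
  by have := @L0_homogeneous 0 0; rewrite !scale0r rnorm0 => ->.
have := @D_lipschitz3 _ 0 (rad_lt s0 (lexx _)).
rewrite -!/(L0 _) L00 !subr0 rnorm0 => /(_ r0).
by rewrite rnorm_scale_real // mulrA mulrAC.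
Qed.

(** Rescaling [h] to [t h] of norm [r / 2] gives [f (x + h) - f x - L h = (D x (x + h) (t h) - D x x
    (t h)) / t], of norm at most [2 K / r] times the squared norm of [h]. *)
Lemma differentiable_of_difference : differentiable f x.
Proof.
pose dL : {linear V -> W} := HB.pack L (GRing.isLinear.Build R[i] V W *:%R L L_linear).
have cL : continuous dL.
  move=> h; apply/cvg_rnormP => e e0; apply/nbhs_rnormP.
  have K10 : 0 < K + 1 by rewrite ltr_wpDl.
  exists (e / (K + 1)); first by rewrite divr_gt0.
  move=> k; rewrite ltr_pdivlMr // => ke; rewrite -linearB /=.
  apply: le_lt_trans (L_bounded _) _; apply: le_lt_trans ke.
  by rewrite mulrC ler_wpM2l ?rnorm_ge0 // lerDl.
have fL : f \o shift x = cst (f x) + dL +o_ 0 id.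
  apply/eqaddoP => _ /complex_gt0_real[e e0 ->].
  have K10 : 0 < K + 1 by rewrite ltr_wpDl.
  (* The first bound keeps [x + h] near [x]; the second makes the quadratic remainder at most [e]
     times the norm of [h]. *)
  apply/nbhs_rnormP; exists (Num.min (r / 2) (e * r / 2 / (K + 1))).
    by rewrite lt_min !divr_gt0 // mulr_gt0.
  move=> h; rewrite subr0 lt_min => /andP[hr].
  rewrite ltr_pdivlMr // => he.
  rewrite /= !rnormE -rmorphM /= lecR.
  have -> : (f \o shift x - (cst (f x) + dL)) h = f (h + x) - f x - L h.
    by rewrite !fctE /= opprD addrA.
  have [->|h0] := eqVneq h 0.
    by rewrite add0r subrr [L 0](linear0 dL) subrr !rnorm0 mulr0.
  have nh0 : 0 < rnorm h.
    rewrite lt_neqAle rnorm_ge0 andbT eq_sym; apply: contraNneq h0 => nh.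
    by rewrite (rnorm0_eq0 nh).
  pose t := r / 2 / rnorm h; have t0 : 0 < t by rewrite !divr_gt0.
  have tC0 := realC_neq0 t0.
  have th : rnorm (t%:C *: h) = r / 2 by rewrite rnorm_scale_real // divfK ?gt_eqF.
  have thr : rnorm (t%:C *: h) < r by rewrite th ltr_pdivrMr // ltr_pMr // ltr1n.
  have nhx : near_x (h + x).
    by rewrite /near_x addrK (lt_trans hr) // ltr_pdivrMr // ltr_pMr // ltr1n.
  have fE : f (h + x) - f x = t%:C^-1 *: D x (h + x) (t%:C *: h).
    have := @DE x (h + x) t%:C near_xx nhx; rewrite addrK => -> //.
    by rewrite scalerA mulVf // scale1r.
  rewrite fE (LE tC0 thr) -scalerBr rnormZ rnormV rnorm_real gtr0_norm //.
  rewrite mulrC ler_pdivrMr //.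
  apply: le_trans (D_lipschitz near_xx nhx near_xx near_xx thr) _.
  rewrite subrr rnorm0 add0r addrK -mulrA [_ * t]mulrC divfK ?gt_eqF // mulrA.
  by apply: le_trans (ltW he); rewrite mulrC ler_wpM2l ?rnorm_ge0 // lerDl.
by apply/diff_locallyP; rewrite (diff_unique cL fL).
Qed.

End DifferenceDifferential.

(** * Nc-functions on nc-domains *)

Section MatrixNorm.
Context {R : realType}.

Lemma rnorm_mx_entry m n (A : 'M[R[i]]_(m, n)) i j : rnorm (A i j) <= rnorm A.
Proof.
rewrite -lecR -!rnormE [leRHS](mx_normE A) -[leLHS]nngE num_le.
exact: (le_bigmax _ _ (i, j)).
Qed.

Lemma rnorm_mx_le m n (A : 'M[R[i]]_(m, n)) (r : R) : 0 <= r ->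
  (forall i j, rnorm (A i j) <= r) -> rnorm A <= r.
Proof.
move=> r0 Ar; have [A0|/mx_norm_neq0[[i j] /= Aij]] := eqVneq (mx_norm A) 0.
  by rewrite /rnorm [X in complex.Re X](_ : _ = 0) //; exact: A0.
by rewrite /rnorm [X in complex.Re X](_ : _ = `|A i j|) //; exact: Ar.
Qed.

Lemma rnorm_block_mx m n p q (A : 'M[R[i]]_(m, n)) (B : 'M[R[i]]_(m, p))
    (C : 'M[R[i]]_(q, n)) (D : 'M[R[i]]_(q, p)) :
  rnorm (block_mx A B C D) <= rnorm A + rnorm B + rnorm C + rnorm D.
Proof.
apply: rnorm_mx_le => [|i j]; first by rewrite !addr_ge0 ?rnorm_ge0.
have le4 (a b c e x : R) : 0 <= a -> 0 <= b -> 0 <= c -> 0 <= e ->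
    or4 (x <= a) (x <= b) (x <= c) (x <= e) -> x <= a + b + c + e.
  by move=> ? ? ? ? [] ?; lra.
apply: le4; rewrite ?rnorm_ge0 //.
by case: (split_ordP i) => k ->; case: (split_ordP j) => l ->;
  rewrite ?(block_mxEul, block_mxEur, block_mxEdl, block_mxEdr);
  [apply: Or41|apply: Or42|apply: Or43|apply: Or44]; exact: rnorm_mx_entry.
Qed.

End MatrixNorm.

Section GradedNorm.
Context {R : realType} {H : completeNormedModType R[i]}.

Lemma rnorm_grop n (A : grop H n) : rnorm A = opnorm A.
Proof. by apply: complexI; rewrite -rnormE grop_normE. Qed.

Lemma rnorm_grop_entry n (A : grop H n) i j : rnorm (A i j) <= rnorm A.
Proof.
pose e : 'cV[R[i]]_n := delta_mx j 0.
have e1 : l2norm e <= 1.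
  apply: le_trans (l2norm_sum _) _; rewrite (bigD1 j) // big1 ?addr0.
    by rewrite [leLHS]addr0 mxE !eqxx andbT [X in complex.Re X]normr1 lexx.
  by move=> k /andP[_ kj]; rewrite mxE (negbTE kj) [X in complex.Re X]normr0.
rewrite rnorm_grop; apply: le_trans (gapp_le_opnorm A e1).
apply: le_trans (l2norm_coord _ i); rewrite mxE (bigD1 j) //= big1 ?addr0.
  by rewrite mxE !eqxx scale1r.
by move=> k kj; rewrite mxE (negbTE kj) /= scale0r.
Qed.

Lemma rnorm_grop_le_sum n (A : grop H n) : rnorm A <= \sum_i \sum_j rnorm (A i j).
Proof.
rewrite rnorm_grop; apply: opnorm_le => v v1.
apply: le_trans (l2norm_sum _) _; apply: ler_sum => i _; rewrite mxE.
apply: le_trans (rnorm_sum _) _; apply: ler_sum => j _.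
rewrite rnormZ -[leRHS]mul1r ler_wpM2r ?rnorm_ge0 //.
exact: le_trans (l2norm_coord v j) v1.
Qed.

(** Applying [U] entrywise commutes with [gapp], so [U] acts on the coordinates of each [gapp A v]
    and preserves their norms. *)
Lemma rnorm_map_isometry (U : {linear H -> H}) n (A : grop H n) :
  (forall x, rnorm (U x) = rnorm x) -> rnorm (map_mx U A : grop H n) = rnorm A.
Proof.
move=> Un; rewrite !rnorm_grop /opnorm; congr sup; apply/eq_imagel => v _.
rewrite /l2norm; congr Num.sqrt; apply: eq_bigr => i _; congr (_ ^+ 2).
rewrite -/(rnorm _) -/(rnorm (gapp A v i 0)) -[RHS]Un !mxE linear_sum; congr rnorm.
by apply: eq_bigr => j _; rewrite mxE linearZ.
Qed.

Definition corner n (A : grop H (n + n)) : grop H n := ursubmx A.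

Lemma cornerB n (A B : grop H (n + n)) : corner (A - B) = corner A - corner B.
Proof. by apply/matrixP => i j; rewrite !mxE. Qed.

Lemma rnorm_corner n (A : grop H (n + n)) :
  rnorm (corner A) <= (n * n)%:R * rnorm A.
Proof.
apply: le_trans (rnorm_grop_le_sum _) _.
apply: (@le_trans _ _ (\sum_(i < n) \sum_(j < n) rnorm A)).
  apply: ler_sum => i _; apply: ler_sum => j _.
  by rewrite [corner A i j]mxE mxE; exact: rnorm_grop_entry.
by rewrite !sumr_const !card_ord -mulrnA mulr_natl.
Qed.

End GradedNorm.

(** * Block upper triangular tuples and shears *)

Section BlockTuples.
Context {R : realType} {d n : nat}.
Implicit Types x y z h : mtuple R d n.

Definition blk y h z : mtuple R d (n + n) :=
  [ffun i => block_mx (y i) (h i) 0 (z i)].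

Lemma blkB y h z y' h' z' :
  blk y h z - blk y' h' z' = blk (y - y') (h - h') (z - z').
Proof.
by apply/ffunP => i; rewrite !ffunE opp_block_mx add_block_mx subrr.
Qed.

Lemma dsum_blk y z : dsum y z = blk y 0 z.
Proof. by apply/ffunP => i; rewrite !ffunE. Qed.

Lemma rnorm_mtuple m (x : mtuple R d m) : rnorm x = \sum_i rnorm (x i).
Proof.
apply: complexI; rewrite -rnormE rmorph_sum /=.
by apply: eq_bigr => i _; rewrite -rnormE.
Qed.

Lemma rnorm_blk y h z : rnorm (blk y h z) <= rnorm y + rnorm h + rnorm z.
Proof.
rewrite !rnorm_mtuple -!big_split; apply: ler_sum => i _; rewrite ffunE.
by apply: le_trans (rnorm_block_mx _ _ _ _) _; rewrite rnorm0 addr0.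
Qed.

Definition shear (c : R[i]) : 'M[R[i]]_(n + n) := block_mx 1%:M c%:M 0 1%:M.

Lemma shear_mul c : shear c *m shear (- c) = 1%:M.
Proof.
rewrite /shear mulmx_block !mulmx1 !mul1mx !mulmx0 !mul0mx !addr0 !add0r.
by rewrite raddfN /= addNr -scalar_mx_block.
Qed.

Lemma shear_unit c : shear c \in unitmx.
Proof. by have [] := mulmx1_unit (shear_mul c). Qed.

Lemma invmx_shear c : invmx (shear c) = shear (- c).
Proof. by rewrite -[RHS](mulKmx (shear_unit c)) shear_mul mulmx1. Qed.

Lemma conj_shear c y z : conj_tuple (shear c) (dsum y z) = blk y (c *: (z - y)) z.
Proof.
apply/ffunP => i; rewrite !ffunE invmx_shear /shear !mulmx_block.
rewrite !mulmx1 !mul1mx !mulmx0 !mul0mx !addr0 !add0r mul_scalar_mx mul_mx_scalar.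
by congr block_mx; rewrite ?mul0mx ?add0r // scaleNr scalerBr addrC.
Qed.

End BlockTuples.

(** Counterpart of [conj_shear] for function values. With entries in [H] the products are not matrix
    products over a ring, so the block is computed entrywise, isolating the nonzero terms of each
    sum. *)
Lemma corner_shear (R : realType) (H : completeNormedModType R[i]) n (c : R[i])
    (A B : grop H n) :
  corner (gmulr (gmull (shear c) (gdsum A B)) (shear (- c))) = c *: (B - A).
Proof.
apply/matrixP => i j; rewrite !mxE big_split_ord /=.
rewrite (bigD1 j) //= big1 ?addr0 => [|k kj]; last first.
  by rewrite block_mxEur mxE (negbTE kj) mulr0n scale0r.
rewrite (bigD1 j) //= big1 ?addr0 => [|k kj]; last first.
  by rewrite block_mxEdr mxE (negbTE kj) scale0r.
rewrite block_mxEur block_mxEdr !mxE !eqxx mulr1n scale1r !big_split_ord /=.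
rewrite (bigD1 i) //= big1 ?addr0 => [|k ki]; last first.
  by rewrite /shear block_mxEul mxE eq_sym (negbTE ki) scale0r.
rewrite [X in _ *: (_ + X)]big1 ?addr0 => [|k _]; last first.
  by rewrite /gdsum block_mxEdl [X in _ *: X]mxE scaler0.
rewrite [X in _ + (X + _)]big1 ?add0r => [|k _]; last first.
  by rewrite /gdsum block_mxEur [X in _ *: X]mxE scaler0.
rewrite (bigD1 i) //= big1 ?addr0 => [|k ki]; last first.
  by rewrite /shear block_mxEur mxE eq_sym (negbTE ki) mulr0n scale0r.
rewrite /shear /gdsum block_mxEul block_mxEur block_mxEul block_mxEdr.
by rewrite !mxE !eqxx mulr1n scale1r scalerBr scaleNr addrC.
Qed.

(** * The difference-differential operator and Lipschitz bounds *)

Section NCFunctions.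
Context {R : realType} {d : nat} {H : completeNormedModType R[i]}.
Implicit Types (B Omega : set (Md R d)) (f : gfun R d H).

Definition nc_bounded B f (M : R) :=
  nc_function B f /\ forall n (y : mtuple R d n.+1), B (pt y) -> rnorm (f n y) <= M.

Lemma nc_functionS B Omega f : B `<=` Omega -> nc_function Omega f -> nc_function B f.
Proof.
move=> BO [fD fS]; split=> [m n x y Bx By Bxy|n S x Su Bx BSx].
  by apply: fD; exact: BO.
by apply: fS => //; exact: BO.
Qed.

(* [blk] with its dimension [n.+1 + n.+1] in the form required by [pt]. *)
Definition bpt n (y h z : mtuple R d n.+1) : mtuple R d (n + n.+1).+1 := blk y h z.

Lemma bptB n (y h z y' h' z' : mtuple R d n.+1) :
  bpt y h z - bpt y' h' z' = bpt (y - y') (h - h') (z - z').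
Proof. exact: (@blkB R d n.+1). Qed.

Lemma rnorm_bpt n (y h z : mtuple R d n.+1) :
  rnorm (bpt y h z) <= rnorm y + rnorm h + rnorm z.
Proof. exact: (@rnorm_blk R d n.+1). Qed.

(* The difference-differential operator of nc-function theory. *)
Definition ddiff f n (y z h : mtuple R d n.+1) : grop H n.+1 :=
  corner (f (n + n.+1)%N (bpt y h z) : grop H (n.+1 + n.+1)).

Lemma ddiffE B f n (y z : mtuple R d n.+1) c : nc_function B f ->
  B (pt y) -> B (pt z) -> B (pt (bpt y 0 z)) -> B (pt (bpt y (c *: (z - y)) z)) ->
  ddiff f y z (c *: (z - y)) = c *: (f n z - f n y).
Proof.
move=> [fD fS] By Bz Byz Byhz; rewrite /ddiff -corner_shear; congr corner.
have Byz' : B (@pt R d (n + n.+1) (dsum y z)) by rewrite dsum_blk.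
(* The sizes [(n + n.+1).+1] and [n.+1 + n.+1] are convertible, so the block lemmas apply once types
   are annotated. *)
have := fS (n + n.+1)%N (@shear R n.+1 c) (dsum y z) (@shear_unit R n.+1 c) Byz'.
have -> : @conj_tuple R d (n + n.+1).+1 (@shear R n.+1 c) (dsum y z) =
    bpt y (c *: (z - y)) z := @conj_shear R d n.+1 c y z.
move=> /(_ Byhz) ->; rewrite fD //.
by have -> : @invmx _ (n + n.+1).+1 (@shear R n.+1 c) = @shear R n.+1 (- c) :=
  @invmx_shear R n.+1 c.
Qed.

(** Openness is used at [x] and at [bpt x 0 x] of doubled size, which lies in [B] because [B] is
    closed under direct sums. *)
Lemma nc_nbhs B n (x : mtuple R d n.+1) : nc_domain B -> B (pt x) ->
  exists2 r : R, 0 < r & forall y z h : mtuple R d n.+1,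
    rnorm (y - x) < r -> rnorm (z - x) < r -> rnorm h < r ->
    B (pt y) /\ B (pt (bpt y h z)).
Proof.
move=> [Bo BD] Bx.
have /nbhs_rnormP[r1 r10 xr1] : nbhs x (slice B n).
  by apply: open_nbhs_nbhs; split=> //; exact: Bo.
have /nbhs_rnormP[r2 r20 xr2] : nbhs (bpt x 0 x) (slice B (n + n.+1)).
  apply: open_nbhs_nbhs; split; first exact: Bo.
  by rewrite /slice /= /bpt -dsum_blk; exact: BD.
exists (Num.min r1 (r2 / 3)); first by rewrite lt_min r10 divr_gt0.
move=> y z h; rewrite !lt_min => /andP[y1 y2] /andP[_ z2] /andP[_ h2].
split; first exact: xr1.
apply: xr2; rewrite bptB subr0.
by apply: le_lt_trans (rnorm_bpt _ _ _) _; lra.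
Qed.

(** [r] and [K] are chosen before [f]; this uniformity gives equi-Lipschitz bounds for a
    sequence. *)
Lemma nc_lipschitz B n (x : mtuple R d n.+1) (M : R) :
  nc_domain B -> B (pt x) -> 0 <= M ->
  exists r K : R, [/\ 0 < r, 0 <= K & forall y z : mtuple R d n.+1,
    rnorm (y - x) < r -> rnorm (z - x) < r -> B (pt y) /\
    forall f, nc_bounded B f M -> rnorm (f n y - f n z) <= K * rnorm (y - z)].
Proof.
move=> Bd Bx M0; have [r r0 xr] := nc_nbhs Bd Bx.
(* The factors come from [rnorm_corner], from the bound on [f], and from dividing by the shear
   parameter [t] below, which makes the off-diagonal block have norm [r / 2]. *)
pose K := (n.+1 * n.+1)%:R * M * (2 / r).
have K0 : 0 <= K by rewrite !mulr_ge0 // ?invr_ge0 ltW.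
exists r, K; split=> // y z yx zx.
have B0 a b : rnorm (a - x) < r -> rnorm (b - x) < r -> B (pt a) /\ B (pt (bpt a 0 b)).
  by move=> ax bx; apply: xr => //; rewrite rnorm0.
split=> [|f [fnc fM]]; first by have [] := B0 y z yx zx.
have [->|yz] := eqVneq y z; first by rewrite !subrr !rnorm0 mulr0.
have nyz : 0 < rnorm (z - y).
  rewrite lt_neqAle rnorm_ge0 andbT eq_sym; apply: contraNneq yz => nh.
  by apply/eqP/esym/subr0_eq; exact: rnorm0_eq0.
pose t := r / 2 / rnorm (z - y); have t0 : 0 < t by rewrite !divr_gt0.
have th : rnorm (t%:C *: (z - y)) < r.
  rewrite rnormZ rnorm_real gtr0_norm // divfK ?gt_eqF //.
  by rewrite ltr_pdivrMr // ltr_pMr // ltr1n.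
have [Byh] := xr y z _ yx zx th; have [By Byz] := B0 y z yx zx.
have [Bz _] := B0 z y zx yx => Byhz.
have := ddiffE fnc By Bz Byz Byhz; move/(congr1 (@rnorm R _)).
rewrite rnormZ rnorm_real gtr0_norm // => E.
have : t * rnorm (f n z - f n y) <= (n.+1 * n.+1)%:R * M.
  rewrite -E; apply: le_trans (rnorm_corner _) _; rewrite ler_wpM2l //.
  exact: fM.
rewrite rnorm_distC -ler_pdivlMl // => /le_trans; apply.
rewrite (rnorm_distC y) /t /K !invfM !invrK [leRHS]mulrC.
rewrite le_eqVlt; apply/orP; left; apply/eqP; ring.
Qed.

(** [nc_lipschitz] at the doubled point [bpt x 0 x] makes [ddiff f] Lipschitz in all three
    arguments, as [differentiable_of_difference] requires. *)
Lemma nc_differentiable B f n (x : mtuple R d n.+1) (M : R) :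
  nc_domain B -> B (pt x) -> nc_bounded B f M -> differentiable (f n) x.
Proof.
move=> Bd Bx fB; have [fnc fM] := fB.
have M0 : 0 <= M by exact: le_trans (rnorm_ge0 _) (fM n x Bx).
have [r1 r10 xr1] := nc_nbhs Bd Bx.
have Bxx : B (pt (bpt x 0 x)).
  by have [] := xr1 x x 0; rewrite ?subrr ?rnorm0.
have [r2 [K [r20 K0 xr2]]] := nc_lipschitz Bd Bxx M0.
pose r := Num.min r1 (r2 / 3).
have r0 : 0 < r by rewrite lt_min r10 divr_gt0.
have rr1 : r <= r1 by rewrite ge_min lexx.
have rr2 : r <= r2 / 3 by rewrite ge_min lexx orbT.
pose K' := (n.+1 * n.+1)%:R * K.
have K'0 : 0 <= K' by rewrite mulr_ge0.
have lip y z h y' z' h' : rnorm (y - x) < r -> rnorm (z - x) < r -> rnorm h < r ->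
    rnorm (y' - x) < r -> rnorm (z' - x) < r -> rnorm h' < r ->
    rnorm (ddiff f y z h - ddiff f y' z' h') <=
    K' * (rnorm (y - y') + rnorm (h - h') + rnorm (z - z')).
  move=> yx zx hr yx' zx' hr'; rewrite /ddiff -cornerB.
  apply: le_trans (rnorm_corner _) _; rewrite -mulrA ler_wpM2l //.
  have near_bpt a b c : rnorm (a - x) < r -> rnorm (b - x) < r -> rnorm c < r ->
      rnorm (bpt a c b - bpt x 0 x) < r2.
    move=> ax bx cr; rewrite bptB subr0.
    by apply: le_lt_trans (rnorm_bpt _ _ _) _; lra.
  have [_ /(_ f fB) flip] := xr2 _ _ (near_bpt _ _ _ yx zx hr)
    (near_bpt _ _ _ yx' zx' hr').
  apply: le_trans flip _; rewrite ler_wpM2l // bptB.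
  exact: rnorm_bpt.
apply: (@differentiable_of_difference R _ _ (f n) x (@ddiff f n) r K' r0 K'0).
- move=> y z c yx zx cr.
  have lt1 a : a < r -> a < r1 by move=> ar; exact: lt_le_trans ar rr1.
  have [By Byhz] := xr1 _ _ _ (lt1 _ yx) (lt1 _ zx) (lt1 _ cr).
  have B0r1 : rnorm (0 : mtuple R d n.+1) < r1 by rewrite rnorm0.
  have [_ Byz] := xr1 _ _ _ (lt1 _ yx) (lt1 _ zx) B0r1.
  have [Bz _] := xr1 z z _ (lt1 _ zx) (lt1 _ zx) (lt1 _ cr).
  by apply: ddiffE fnc _ _ _ _.
- move=> y z y' z' h yx zx yx' zx' hr.
  by have := lip y z h y' z' h yx zx hr yx' zx' hr; rewrite subrr rnorm0 addr0.
- move=> h h' hr hr'; have xx : rnorm (x - x) < r by rewrite subrr rnorm0.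
  by have := lip x x h x x h' xx xx hr xx xx hr'; rewrite subrr rnorm0 add0r addr0.
Qed.

End NCFunctions.

(** * Limits of nc-functions *)

Section RationalPoints.
Context {R : realType} {d : nat}.

Definition ratr_complex (p : rat * rat) : R[i] := ratr p.1 +i* ratr p.2.

Definition rat_tuple n (q : {ffun 'I_d -> 'M[rat * rat]_n}) : mtuple R d n :=
  [ffun k => map_mx ratr_complex (q k)].

Lemma ratr_complex_dense (z : R[i]) (e : R) : 0 < e ->
  exists p, rnorm (ratr_complex p - z) < e.
Proof.
have dense (x r : R) : 0 < r -> exists q : rat, `|ratr q - x| < r.
  move=> r0; have /rat_in_itvoo[q] : x - r < x + r by rewrite ltrD2l; lra.
  by rewrite in_itv /= => xq; exists q; rewrite ltr_distl.
case: z => a b e0; have e20 : 0 < e / 2 by rewrite divr_gt0.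
have [p pa] := dense a _ e20; have [q qb] := dense b _ e20.
exists (p, q); rewrite [X in rnorm X]complexE; apply: le_lt_trans (rnormD _ _) _.
rewrite rnormM !rnorm_real /= [X in _ + X * _](_ : _ = 1).
  by rewrite mul1r [e]splitr ltrD.
by rewrite /rnorm normc_def /= expr0n expr1n add0r sqrtr1.
Qed.

Lemma rat_tuple_dense n (x : mtuple R d n) (e : R) : 0 < e ->
  exists q, rnorm (rat_tuple q - x) < e.
Proof.
move=> e0; pose r := e / d.+1%:R; have r0 : 0 < r by rewrite divr_gt0 // ltr0n.
have /choice[g gP] : forall t : 'I_d * ('I_n * 'I_n), exists p : rat * rat,
    rnorm (ratr_complex p - x t.1 t.2.1 t.2.2) < r.
  by move=> t; exact: ratr_complex_dense.
exists [ffun k => \matrix_(i, j) g (k, (i, j))]; rewrite rnorm_mtuple.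
apply: (@le_lt_trans _ _ (\sum_(k < d) r)).
  apply: ler_sum => k _; apply: rnorm_mx_le => [|i j]; first exact: ltW.
  by rewrite !ffunE !mxE ltW // (gP (k, (i, j))).
rewrite sumr_const card_ord -[ltLHS]mulr_natr mulrAC ltr_pdivrMr ?ltr0n //.
by rewrite ltr_pM2l // ltr_nat.
Qed.

End RationalPoints.

Section GradedLimits.
Context {R : realType} {H : completeNormedModType R[i]}.
Variables (F : set_system nat) (FF : Filter F).

Lemma cvg_gropP n (A : nat -> grop H n) (B : grop H n) :
  A l @[l --> F] --> B <-> forall i j, A l i j @[l --> F] --> B i j.
Proof.
split=> [/cvg_rnormP AB i j|AB]; apply/cvg_rnormP => e e0.
  apply: filterS (AB e e0) => l; apply: le_lt_trans.
  by have := rnorm_grop_entry (A l - B) i j; rewrite !mxE.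
pose r := e / (n * n).+1%:R; have r0 : 0 < r by rewrite divr_gt0 // ltr0n.
have : \forall l \near F, forall t : 'I_n * 'I_n, rnorm (A l t.1 t.2 - B t.1 t.2) < r.
  by apply: filter_forall => t; move/cvg_rnormP : (AB t.1 t.2); exact.
apply: filterS => l Al; apply: le_lt_trans (rnorm_grop_le_sum _) _.
apply: (@le_lt_trans _ _ (\sum_(i < n) \sum_(j < n) r)).
  by apply: ler_sum => i _; apply: ler_sum => j _; rewrite !mxE ltW // (Al (i, j)).
rewrite !sumr_const !card_ord -mulrnA -[ltLHS]mulr_natr mulrAC ltr_pdivrMr ?ltr0n //.
by rewrite ltr_pM2l // ltr_nat.
Qed.

Lemma cvg_lin_comb n (c : 'I_n -> R[i]) (x : 'I_n -> nat -> H) (y : 'I_n -> H) :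
  (forall i, x i l @[l --> F] --> y i) ->
  \sum_i c i *: x i l @[l --> F] --> \sum_i c i *: y i.
Proof.
by move=> xy; apply: cvg_big => [|i _]; [exact: add_continuous|exact: cvgZl_tmp].
Qed.

Lemma cvg_gdsum m n (A : nat -> grop H m) (B : nat -> grop H n) A0 B0 :
  A l @[l --> F] --> A0 -> B l @[l --> F] --> B0 ->
  gdsum (A l) (B l) @[l --> F] --> gdsum A0 B0.
Proof.
move=> /cvg_gropP AA0 /cvg_gropP BB0; apply/cvg_gropP => i j.
case: (split_ordP i) => k ->; case: (split_ordP j) => h ->.
- under eq_cvg do rewrite block_mxEul; rewrite block_mxEul; exact: AA0.
- under eq_cvg do rewrite block_mxEur mxE; rewrite block_mxEur mxE; exact: cvg_cst.
- under eq_cvg do rewrite block_mxEdl mxE; rewrite block_mxEdl mxE; exact: cvg_cst.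
- under eq_cvg do rewrite block_mxEdr; rewrite block_mxEdr; exact: BB0.
Qed.

Lemma cvg_gmull n (S : 'M[R[i]]_n) (A : nat -> grop H n) A0 :
  A l @[l --> F] --> A0 -> gmull S (A l) @[l --> F] --> gmull S A0.
Proof.
move=> /cvg_gropP AA0; apply/cvg_gropP => i j.
by under eq_cvg do rewrite mxE; rewrite mxE; exact: cvg_lin_comb.
Qed.

Lemma cvg_gmulr n (S : 'M[R[i]]_n) (A : nat -> grop H n) A0 :
  A l @[l --> F] --> A0 -> gmulr (A l) S @[l --> F] --> gmulr A0 S.
Proof.
move=> /cvg_gropP AA0; apply/cvg_gropP => i j.
by under eq_cvg do rewrite mxE; rewrite mxE; exact: cvg_lin_comb.
Qed.

End GradedLimits.

Section NCLimits.
Context {R : realType} {d : nat} {H : completeNormedModType R[i]}.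
Implicit Types (B Omega : set (Md R d)) (f : gfun R d H) (U : {linear H -> H}).

Lemma map_gdsum U m n (A : grop H m) (B : grop H n) :
  map_mx U (gdsum A B) = gdsum (map_mx U A) (map_mx U B).
Proof. by rewrite /gdsum map_block_mx !map_mx0. Qed.

Lemma nc_function_gact B f U : nc_function B f -> nc_function B (gact U f).
Proof.
move=> [fD fS]; split=> [m n x y Bx By Bxy|n S x Su Bx BSx]; rewrite /gact.
  by rewrite fD // [LHS](map_gdsum U (f m x)).
rewrite fS //; apply/matrixP => i j; rewrite !mxE linear_sum.
apply: eq_bigr => k _; rewrite linearZ !mxE linear_sum; congr (_ *: _).
by apply: eq_bigr => l _; rewrite linearZ !mxE.
Qed.

(** Both nc identities pass to pointwise limits, which are unique. *)
Lemma nc_function_cvg B (w : nat -> gfun R d H) v :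
  (forall l, nc_function B (w l)) ->
  (forall n (x : mtuple R d n.+1), B (pt x) -> w l n x @[l --> \oo] --> v n x) ->
  nc_function B v.
Proof.
move=> wnc wv; split=> [m n x y Bx By Bxy|n S x Su Bx BSx].
  apply: (norm_cvg_unique (wv _ _ Bxy)).
  have -> : (fun l => w l (m + n.+1)%N (dsum x y)) = fun l => gdsum (w l m x) (w l n y).
    by apply/funext => l; rewrite (proj1 (wnc l)).
  by apply: (cvg_gdsum _ (wv _ _ Bx) (wv _ _ By)).
apply: (norm_cvg_unique (wv _ _ BSx)).
have -> : (fun l => w l n (conj_tuple S x)) =
    fun l => gmulr (gmull S (w l n x)) (invmx S).
  by apply/funext => l; rewrite (proj2 (wnc l)).
by apply: cvg_gmulr; apply: cvg_gmull; exact: wv.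
Qed.

End NCLimits.

(** * Limits of equi-Lipschitz sequences *)

Section EquicontinuousLimits.
Context {R : realType} {d : nat} {H : completeNormedModType R[i]}.
Variables (Omega : set (Md R d)) (w : nat -> gfun R d H).
Arguments w : clear implicits.

(** One pair [r], [K] serves every [l]; the clause on [Omega] puts a ball around each of its points
    inside it. *)
Definition equi_lipschitz := forall n (x : mtuple R d n.+1), Omega (pt x) ->
  exists r K : R, [/\ 0 < r, 0 <= K & forall y z : mtuple R d n.+1,
    rnorm (y - x) < r -> rnorm (z - x) < r ->
    Omega (pt y) /\ forall l, rnorm (w l n y - w l n z) <= K * rnorm (y - z)].

Hypothesis w_lip : equi_lipschitz.

Lemma equi_lipschitz_small n (x : mtuple R d n.+1) (e : R) : Omega (pt x) -> 0 < e ->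
  exists2 r : R, 0 < r & forall y : mtuple R d n.+1, rnorm (y - x) < r ->
    Omega (pt y) /\ forall l, rnorm (w l n y - w l n x) <= e.
Proof.
move=> /w_lip[r [K [r0 K0 lip]]] e0; have K10 : 0 < K + 1 by rewrite ltr_wpDl.
exists (Num.min r (e / (K + 1))); first by rewrite lt_min r0 divr_gt0.
move=> y; rewrite lt_min => /andP[yr ye].
have xx : rnorm (x - x) < r by rewrite subrr rnorm0.
have [Oy lipy] := lip y x yr xx; split=> // l; apply: le_trans (lipy l) _.
move: ye; rewrite ltr_pdivlMr // => /ltW; apply: le_trans.
by rewrite mulrC ler_wpM2l ?rnorm_ge0 // lerDl.
Qed.

Lemma cvg_of_rational_points :
  (forall n (q : {ffun 'I_d -> 'M[rat * rat]_n.+1}), Omega (pt (rat_tuple q)) ->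
     forall i j, exists y : H, w l n (rat_tuple q) i j @[l --> \oo] --> y) ->
  exists v : gfun R d H, forall n (x : mtuple R d n.+1),
    Omega (pt x) -> w l n x @[l --> \oo] --> v n x.
Proof.
move=> wq.
suff wx n (x : mtuple R d n.+1) : Omega (pt x) ->
    exists A : grop H n.+1, w l n x @[l --> \oo] --> A.
  exists (fun n x => xget 0 [set A : grop H n.+1 | w l n x @[l --> \oo] --> A]).
  move=> n x /wx wA.
  exact: (@xgetPex _ 0 [set A : grop H n.+1 | w l n x @[l --> \oo] --> A] wA).
move=> Ox.
have /choice[a aP] : forall t : 'I_n.+1 * 'I_n.+1, exists y : H,
    w l n x t.1 t.2 @[l --> \oo] --> y.
  move=> [i j] /=.
  suff : cvg (w l n x i j @[l --> \oo]) by move=> wxij; exists (lim (w l n x i j @[l --> \oo])).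
  (* [H] is complete, and the Cauchy criterion asks only for a centre [e]-close to the tail: the
     limit at a nearby rational point serves. *)
  apply: cauchy_cvg; apply: cauchy_exP => _ /complex_gt0_real[e e0 ->].
  have e20 : 0 < e / 2 by rewrite divr_gt0.
  have [r r0 wr] := equi_lipschitz_small Ox e20.
  have [q qx] := rat_tuple_dense x r0; have [Oq wqx] := wr _ qx.
  have [y /cvg_rnormP wy] := wq n q Oq i j; exists y.
  apply: filterS (wy _ e20) => l wly; rewrite -ball_normE /= rnorm_lt rnorm_distC.
  apply: le_lt_trans (rnorm_distD (w l n (rat_tuple q) i j) _ _) _.
  rewrite [e]splitr ler_ltD // rnorm_distC; apply: le_trans (wqx l).
  by have := rnorm_grop_entry (w l n (rat_tuple q) - w l n x) i j; rewrite !mxE.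
exists (\matrix_(i, j) a (i, j)); apply/cvg_gropP => i j; rewrite mxE.
exact: (aP (i, j)).
Qed.

(** Equicontinuity makes convergence at a point uniform near it; compactness makes it uniform on
    each level, and only finitely many levels are nonempty. *)
Lemma cvg_uniform_on_compact (v : gfun R d H) :
  (forall n (x : mtuple R d n.+1), Omega (pt x) -> w l n x @[l --> \oo] --> v n x) ->
  forall K, finitely_compact K -> K `<=` Omega ->
  forall e : R, 0 < e -> \forall l \near \oo,
    forall n (x : mtuple R d n.+1), K (pt x) -> `|w l n x - v n x| < e%:C.
Proof.
move=> wv K [Kc [N _ KN]] KO e e0.
have Kn n : \forall l \near \oo, slice K n `<=` [set x | rnorm (w l n x - v n x) < e].
  have /compact_near_coveringP := Kc n.
  apply=> x Kx; have Ox : Omega (pt x) by exact: KO.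
  have e30 : 0 < e / 3 by rewrite divr_gt0.
  have [r r0 wr] := equi_lipschitz_small Ox e30.
  have /cvg_rnormP/(_ _ e30) wx := wv n x Ox.
  exists ([set y | rnorm (y - x) < r], [set l | rnorm (w l n x - v n x) < e / 3]).
    by split=> //=; apply/nbhs_rnormP; exists r.
  move=> [y l] /= [yx wlx]; have [Oy wy] := wr y yx.
  have vy : rnorm (v n y - v n x) <= e / 3.
    apply: (@rnorm_cvg_le _ _ _ \oo _ (fun l => w l n y - w l n x)).
      by apply: cvgB; exact: wv.
    by apply: nearW => k; exact: wy.
  apply: le_lt_trans (rnorm_distD (w l n x) _ _) _.
  apply: le_lt_trans (lerD (wy l) (rnorm_distD (v n x) _ _)) _.
  by rewrite (rnorm_distC (v n x)); lra.
have : \forall l \near \oo, forall n : 'I_N, slice K n `<=`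
    [set x | rnorm (w l n x - v n x) < e] by apply: filter_forall => n; exact: Kn.
apply: filterS => l Kl n x Kx; rewrite rnorm_lt.
have [nN|Nn] := ltnP n N; first exact: (Kl (Ordinal nN)).
by have : slice K n x by []; rewrite KN.
Qed.

End EquicontinuousLimits.

(** * Compactness up to unitaries for bounded sequences of nc-functions *)

Theorem theorem1p7 (R : realType) (d : nat)
    (tau : set (set (Md R d))) (tau_nc : nc_topology tau)
    (Omega : set (Md R d)) (Omega_tau : tau Omega)
    (H : completeNormedModType R[i]) (dot : {dot H for Num.conj})
    (dot_norm : forall x : H, dot x x = `|x| ^+ 2)
    (u : nat -> gfun R d H)
    (u_Hol : forall k, Hol_tau tau Omega (u k))
    (u_bounded : tau_locally_uniformly_bounded tau Omega u) :
  exists (v : gfun R d H) (U : nat -> {linear H -> H}) (kl : nat -> nat),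
    [/\ Hol_tau tau Omega v,
        forall k, unitary dot (U k),
        {homo kl : l m / (l < m)%N}
      & cvg_Hol Omega (fun l => gact (U (kl l)) (u (kl l))) v].
Proof.
have [_ [BB [[BBtau BBbasis] BBnc]]] := tau_nc.
(* Members of tau need not be closed under direct sums, but basic ones are. *)
have BBbound p : Omega p -> exists (B : set (Md R d)) (M : R),
    [/\ tau B, nc_domain B, B p, B `<=` Omega &
      forall k n (y : mtuple R d n.+1), B (pt y) -> rnorm (u k n y) <= M].
  move=> /u_bounded[B [tB Bp BO [M uM]]]; have [B' [BB' B'p B'B]] := BBbasis B tB p Bp.
  exists B', M; split=> //; [exact: BBtau|exact: BBnc|exact: subset_trans BO|].
  by move=> k n y /B'B By; rewrite -rnorm_le; exact: uM.
(* Pairing rational tuples of all sizes with entry positions gives a countable type, so one sequence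
   of rows lists every entry. Points outside [Omega] and invalid codes give zero rows. *)
pose idx n : countType := ({ffun 'I_d -> 'M[rat * rat]_n.+1} * ('I_n.+1 * 'I_n.+1))%type.
pose entry (k : nat) (t : {n : nat & idx n}) : H :=
  let: existT n (q, (i, j)) := t in
  if `[< Omega (pt (rat_tuple q)) >] then u k n (rat_tuple q) i j else 0.
pose x (s k : nat) : H := if @unpickle {n : nat & idx n} s is Some t then entry k t else 0.
have /choice[M xM] : forall s, exists M : R, forall k, rnorm (x s k) <= M.
  move=> s; rewrite /x; case: unpickle => [[n [q [i j]]]|] /=; last first.
    by exists 0 => k; rewrite rnorm0.
  case: asboolP => [Oq|_]; last by exists 0 => k; rewrite rnorm0.
  have [B [M [_ _ Bq _ uM]]] := BBbound _ Oq; exists M => k.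
  exact: le_trans (rnorm_grop_entry _ i j) (uM k n _ Bq).
have [U [kl [y [Uu kl_homo xy]]]] := unitary_bolzano_weierstrass dot_norm xM.
pose w l := gact (U (kl l)) (u (kl l)).
have w_nc l : nc_function Omega (w l).
  by apply: nc_function_gact; have [] := u_Hol (kl l).
have w_bound p : Omega p -> exists (B : set (Md R d)) (M : R),
    [/\ tau B, nc_domain B, B p, B `<=` Omega & forall l, nc_bounded B (w l) M].
  move=> /BBbound[B [M' [tB Bd Bp BO uM]]]; exists B, M'; split=> // l.
  split=> [|n z Bz]; first exact: nc_functionS BO (w_nc l).
  (* Unitaries preserve the operator norm, so the bound for [u] carries over to [w]. *)
  by rewrite rnorm_map_isometry; [exact: uM|exact: rnorm_unitary].
have w_lip : equi_lipschitz Omega w.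
  move=> n z /w_bound[B [M' [_ Bd Bz BO wM]]].
  have M'0 : 0 <= M' by have [_ /(_ n z Bz)] := wM 0%N; apply: le_trans (rnorm_ge0 _).
  have [r [K [r0 K0 lip]]] := @nc_lipschitz R d H B n z M' Bd Bz M'0.
  exists r, K; split=> // a b ar br; have [Ba fab] := lip a b ar br.
  by split=> [|l]; [exact: BO|exact: fab].
have [v wv] : exists v : gfun R d H, forall n (z : mtuple R d n.+1),
    Omega (pt z) -> w l n z @[l --> \oo] --> v n z.
  apply: cvg_of_rational_points w_lip _ => n q Oq i j.
  exists (y (pickle (existT idx n (q, (i, j))))).
  have := xy (pickle (existT idx n (q, (i, j)))); rewrite /x pickleK /= asboolT //.
  by under [X in _ -> X]eq_cvg do rewrite mxE.
have v_nc : nc_function Omega v by exact: nc_function_cvg wv.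
(* Bounds pass to the limit on the same nc-domain; this yields local boundedness of [v] and, by
   [nc_differentiable], its holomorphy. *)
have v_bound B M' : B `<=` Omega -> (forall l, nc_bounded B (w l) M') -> nc_bounded B v M'.
  move=> BO wM; split=> [|n z Bz]; first exact: nc_functionS BO v_nc.
  apply: rnorm_cvg_le (wv n z (BO _ Bz)) _.
  by apply: nearW => l; have [_] := wM l; exact.
exists v, U, kl; split=> //.
  split=> // p /w_bound[B [M' [tB Bd Bp BO wM]]]; exists B; split=> //.
  by exists M' => n z Bz; rewrite rnorm_le; have [_] := v_bound B M' BO wM; exact.
split=> [l n z|n z|].
- by move=> /w_bound[B [M' [_ Bd Bz _ wM]]]; exact: nc_differentiable Bd Bz (wM l).
- move=> /w_bound[B [M' [_ Bd Bz BO wM]]].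
  exact: nc_differentiable Bd Bz (v_bound B M' BO wM).
- exact: cvg_uniform_on_compact w_lip v wv.
Qed.
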